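(* Under Assumptions 1 and 2 (stated in the context), $$\operatorname{epi}_\ge(J_{\mathrm{mix}})\subseteq\pi_{K,\gamma}(\mathcal{L}_{\mathrm{lft}})=\operatorname{cl}\,\operatorname{epi}_\ge(J_{\mathrm{mix}}),$$ where $\pi_{K,\gamma}(\mathcal{L}_{\mathrm{lft}}):=\{(K,\gamma):\exists X,\ (K,\gamma,X)\in\mathcal{L}_{\mathrm{lft}}\}$. Moreover, the map $\Phi(K,\gamma,X):=(\gamma,X,KX)$ is a $C^\infty$ (in particular $C^2$) diffeomorphism from $\mathcal{L}_{\mathrm{lft}}$ onto $\mathcal{F}_{\mathrm{cvx}}$.
   Context: Let $A\in\mathbb{R}^{n\times n}$, $B\in\mathbb{R}^{n\times m}$, $B_w\in\mathbb{R}^{n\times n}$, $W:=B_wB_w^{\mathsf T}$. Let $Q_2\succeq0$, $R_2\succ0$, $Q_\infty\succ0$, $R_\infty\succ0$ be symmetric weight matrices and $\beta>0$. For $K\in\mathbb{R}^{m\times n}$ write $A_K:=A+BK$, $S_K:=Q_\infty+K^{\mathsf T}R_\infty K$. Let $\mathcal{K}:=\{K: A_K \text{ Hurwitz}\}$, $\mathbf{T}_\infty(K)(s)=\begin{bmatrix}Q_\infty^{1/2}\\ R_\infty^{1/2}K\end{bmatrix}(sI-A_K)^{-1}B_w$, $\mathcal{K}_\beta:=\{K\in\mathcal{K}:\|\mathbf{T}_\infty(K)\|_{\mathcal{H}_\infty}<\beta\}$. For $K\in\mathcal{K}_\beta$ let $X_K$ be the unique stabilizing solution (i.e. $A_K+\beta^{-2}X_KS_K$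 Hurwitz) of $A_KX+XA_K^{\mathsf T}+\beta^{-2}XS_KX+W=0$ and $J_{\mathrm{mix}}(K):=\operatorname{tr}((Q_2+K^{\mathsf T}R_2K)X_K)$. $\operatorname{epi}_\ge(J_{\mathrm{mix}}):=\{(K,\gamma)\in\mathcal{K}_\beta\times\mathbb{R}:\gamma\ge J_{\mathrm{mix}}(K)\}$ and $\operatorname{cl}$ denotes closure in $\mathbb{R}^{m\times n}\times\mathbb{R}$. Lifted set: $\mathcal{L}_{\mathrm{lft}}:=\{(K,\gamma,X): K\in\mathbb{R}^{m\times n},\gamma\in\mathbb{R},X\succ0,\ \gamma\ge\operatorname{tr}(Q_2X)+\operatorname{tr}(R_2KXK^{\mathsf T}),\ A_KX+XA_K^{\mathsf T}+\beta^{-2}XS_KX+W\preceq0\}$. Convex set: $\mathcal{F}_{\mathrm{cvx}}:=\{(\gamma,X,Y):\gamma\in\mathbb{R},X\succ0,Y\in\mathbb{R}^{m\times n},\ \mathbb{F}_{\mathrm{cvx}}(X,Y)\preceq0,\ \gamma\ge\operatorname{tr}(Q_2X)+\operatorname{tr}(R_2YX^{-1}Y^{\mathsf T})\}$, where $\mathbb{F}_{\mathrm{cvx}}(X,Y):=\begin{bmatrix}AX+XA^{\mathsf T}+BY+Y^{\mathsf T}B^{\mathsf T}+W & XQ_\infty^{1/2} & Y^{\mathsf T}R_\infty^{1/2}\\ Q_\infty^{1/2}X & -\beta^2I & 0\\ R_\infty^{1/2}Y & 0 & -\beta^2I\end{bmatrix}$. Assumption 1: $(A,B)$ stabilizable,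 $(Q_2^{1/2},A)$ detectable, and $\beta>\inf_{K\in\mathcal{K}}\|\mathbf{T}_\infty(K)\|_{\mathcal{H}_\infty}$. Assumption 2: $Q_2\succeq0$ and $W,Q_\infty,R_2,R_\infty$ positive definite. *)

(* Defs.v *)
From HB Require Import structures.
From mathcomp Require Import all_boot all_order all_algebra.
From mathcomp Require Import all_classical all_reals all_analysis.
From mathcomp Require Import complex.
Import Order.TTheory GRing.Theory Num.Theory.
Import numFieldNormedType.Exports.

Set Implicit Arguments.
Unset Strict Implicit.
Unset Printing Implicit Defensive.

Local Open Scope ring_scope.
Local Open Scope classical_set_scope.

Section MixedH2Hinf.
Context {R : realType}.

Definition cmx {p q : nat} (M : 'M[R]_(p, q)) : 'M[R[i]]_(p, q) :=
  map_mx (fun x => Complex x 0) M.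

Definition Hurwitz {p : nat} (A : 'M[R]_p) : Prop :=
  forall z : R[i], eigenvalue (cmx A) z -> complex.Re z < 0.

Definition symmetric {p : nat} (M : 'M[R]_p) : Prop := M^T = M.

Definition posdef {p : nat} (M : 'M[R]_p) : Prop :=
  symmetric M /\ forall x : 'cV[R]_p, x != 0 -> 0 < (x^T *m M *m x) 0 0.

Definition possemidef {p : nat} (M : 'M[R]_p) : Prop :=
  symmetric M /\ forall x : 'cV[R]_p, 0 <= (x^T *m M *m x) 0 0.

Definition negsemidef {p : nat} (M : 'M[R]_p) : Prop :=
  symmetric M /\ forall x : 'cV[R]_p, (x^T *m M *m x) 0 0 <= 0.

Definition cnorm {p : nat} (v : 'cV[R[i]]_p) : R :=
  Num.sqrt (\sum_(k < p) (complex.Re (v k 0) ^+ 2 + complex.Im (v k 0) ^+ 2)).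

Definition sigma_max {p q : nat} (M : 'M[R[i]]_(p, q)) : \bar R :=
  ereal_sup [set (cnorm (M *m v))%:E | v in [set v : 'cV[R[i]]_q | cnorm v = 1]].

Definition stabilizable {p q : nat} (A : 'M[R]_p) (B : 'M[R]_(p, q)) : Prop :=
  exists K : 'M[R]_(q, p), Hurwitz (A + B *m K).

Definition detectable {p r : nat} (C : 'M[R]_(r, p)) (A : 'M[R]_p) : Prop :=
  exists L : 'M[R]_(p, r), Hurwitz (A + L *m C).

Variables (n m : nat).

Definition AK (A : 'M[R]_n) (B : 'M[R]_(n, m)) (K : 'M[R]_(m, n)) : 'M[R]_n :=
  A + B *m K.

Definition SK (Qinf : 'M[R]_n) (Rinf : 'M[R]_m) (K : 'M[R]_(m, n)) : 'M[R]_n :=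
  Qinf + K^T *m Rinf *m K.

(* T_inf(K)(s) = [Qinf^{1/2}; Rinf^{1/2} K] (sI - A_K)^{-1} B_w,
   Qih, Rih stand for Qinf^{1/2}, Rinf^{1/2} *)
Definition Tinf (A : 'M[R]_n) (B : 'M[R]_(n, m)) (Bw : 'M[R]_n)
  (Qih : 'M[R]_n) (Rih : 'M[R]_m) (K : 'M[R]_(m, n)) (s : R[i])
  : 'M[R[i]]_(n + m, n) :=
  cmx (col_mx Qih (Rih *m K)) *m invmx (s%:M - cmx (AK A B K)) *m cmx Bw.

Definition hinf_norm (A : 'M[R]_n) (B : 'M[R]_(n, m)) (Bw : 'M[R]_n)
  (Qih : 'M[R]_n) (Rih : 'M[R]_m) (K : 'M[R]_(m, n)) : \bar R :=
  ereal_sup [set sigma_max (Tinf A B Bw Qih Rih K (Complex 0 w)) | w in [set: R]].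

Definition Kstab (A : 'M[R]_n) (B : 'M[R]_(n, m)) : set 'M[R]_(m, n) :=
  [set K | Hurwitz (AK A B K)].

Definition Kbeta (A : 'M[R]_n) (B : 'M[R]_(n, m)) (Bw : 'M[R]_n)
  (Qih : 'M[R]_n) (Rih : 'M[R]_m) (beta : R) : set 'M[R]_(m, n) :=
  [set K | Hurwitz (AK A B K) /\ (hinf_norm A B Bw Qih Rih K < beta%:E)%E].

Definition ric (A : 'M[R]_n) (B : 'M[R]_(n, m)) (Bw : 'M[R]_n)
  (Qinf : 'M[R]_n) (Rinf : 'M[R]_m) (beta : R) (K : 'M[R]_(m, n))
  (X : 'M[R]_n) : 'M[R]_n :=
  AK A B K *m X + X *m (AK A B K)^T + beta ^- 2 *: (X *m SK Qinf Rinf K *m X)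
  + Bw *m Bw^T.

Definition stab_sol (A : 'M[R]_n) (B : 'M[R]_(n, m)) (Bw : 'M[R]_n)
  (Qinf : 'M[R]_n) (Rinf : 'M[R]_m) (beta : R) (K : 'M[R]_(m, n))
  (X : 'M[R]_n) : Prop :=
  symmetric X /\ ric A B Bw Qinf Rinf beta K X = 0 /\
  Hurwitz (AK A B K + beta ^- 2 *: (X *m SK Qinf Rinf K)).

(* X_K : the (unique) stabilizing solution *)
Definition XK (A : 'M[R]_n) (B : 'M[R]_(n, m)) (Bw : 'M[R]_n)
  (Qinf : 'M[R]_n) (Rinf : 'M[R]_m) (beta : R) (K : 'M[R]_(m, n)) : 'M[R]_n :=
  xget 0 [set X | stab_sol A B Bw Qinf Rinf beta K X].

Definition Jmix (A : 'M[R]_n) (B : 'M[R]_(n, m)) (Bw : 'M[R]_n)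
  (Q2 : 'M[R]_n) (R2 : 'M[R]_m) (Qinf : 'M[R]_n) (Rinf : 'M[R]_m) (beta : R)
  (K : 'M[R]_(m, n)) : R :=
  \tr ((Q2 + K^T *m R2 *m K) *m XK A B Bw Qinf Rinf beta K).

Definition epi_Jmix (A : 'M[R]_n) (B : 'M[R]_(n, m)) (Bw : 'M[R]_n)
  (Q2 : 'M[R]_n) (R2 : 'M[R]_m) (Qinf Qih : 'M[R]_n) (Rinf Rih : 'M[R]_m)
  (beta : R) : set ('M[R]_(m, n) * R) :=
  [set p | Kbeta A B Bw Qih Rih beta p.1 /\
           Jmix A B Bw Q2 R2 Qinf Rinf beta p.1 <= p.2].

Definition L_lft (A : 'M[R]_n) (B : 'M[R]_(n, m)) (Bw : 'M[R]_n)
  (Q2 : 'M[R]_n) (R2 : 'M[R]_m) (Qinf : 'M[R]_n) (Rinf : 'M[R]_m)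
  (beta : R) : set ('M[R]_(m, n) * R * 'M[R]_n) :=
  [set p | let: (K, g, X) := p in
     posdef X /\
     \tr (Q2 *m X) + \tr (R2 *m K *m X *m K^T) <= g /\
     negsemidef (ric A B Bw Qinf Rinf beta K X)].

Definition proj_Kg (L : set ('M[R]_(m, n) * R * 'M[R]_n)) : set ('M[R]_(m, n) * R) :=
  [set kg | exists X : 'M[R]_n, L (kg.1, kg.2, X)].

Definition Fcvx_mx (A : 'M[R]_n) (B : 'M[R]_(n, m)) (Bw : 'M[R]_n)
  (Qih : 'M[R]_n) (Rih : 'M[R]_m) (beta : R) (X : 'M[R]_n) (Y : 'M[R]_(m, n))
  : 'M[R]_(n + (n + m)) :=
  block_mx (A *m X + X *m A^T + B *m Y + Y^T *m B^T + Bw *m Bw^T)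
           (row_mx (X *m Qih) (Y^T *m Rih))
           (col_mx (Qih *m X) (Rih *m Y))
           ((- beta ^+ 2) %:M).

Definition F_cvx (A : 'M[R]_n) (B : 'M[R]_(n, m)) (Bw : 'M[R]_n)
  (Q2 : 'M[R]_n) (R2 : 'M[R]_m) (Qih : 'M[R]_n) (Rih : 'M[R]_m)
  (beta : R) : set (R * 'M[R]_n * 'M[R]_(m, n)) :=
  [set p | let: (g, X, Y) := p in
     posdef X /\
     negsemidef (Fcvx_mx A B Bw Qih Rih beta X Y) /\
     \tr (Q2 *m X) + \tr (R2 *m Y *m invmx X *m Y^T) <= g].

Definition Phi (p : 'M[R]_(m, n) * R * 'M[R]_n) : R * 'M[R]_n * 'M[R]_(m, n) :=
  let: (K, g, X) := p in (g, X, K *m X).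

End MixedH2Hinf.

Section Smooth.
Context {R : realType} {U V : normedModType R}.

Fixpoint Ck (k : nat) (O : set U) (f : U -> V) : Prop :=
  match k with
  | 0 => forall x, O x -> {for x, continuous f}
  | k'.+1 => (forall x, O x -> {for x, continuous f}) /\
             forall v : U, (forall x, O x -> derivable f x v) /\
                           Ck k' O (fun x => 'D_v f x)
  end.

Definition smooth_open (O : set U) (f : U -> V) : Prop :=
  open O /\ forall k, Ck k O f.

Definition smooth_on (S : set U) (f : U -> V) : Prop :=
  forall p, S p -> exists (W : set U) (g : U -> V),
    W p /\ smooth_open W g /\ (forall q, W q -> S q -> g q = f q).

End Smooth.

Section Diffeo.
Context {R : realType} {U V : normedModType R}.

Definition diffeomorphism_onto (S : set U) (S2 : set V) (f : U -> V) : Prop :=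
  smooth_on S f /\
  exists g : V -> U,
    (forall p, S p -> S2 (f p)) /\ (forall q, S2 q -> S (g q)) /\
    (forall p, S p -> g (f p) = p) /\ (forall q, S2 q -> f (g q) = q) /\
    smooth_on S2 g.

End Diffeo.

(* Main.v *)
(* Write c = beta^-2, S = S_K and H = A_K.  Everything rests on the Riccati
   inequality H X + X H^T + c X S X + W <= 0.

   Bounded real lemma, existence part: if |T_inf(K)| < beta, follow the stabilizing
   solution of H X + X H^T + c X S X + t W = 0 from t = 0 (where X = 0) to t = 1.  The
   admissible t are open to the right by a Banach contraction, and closed because the
   solutions are bounded (take the trace, S > 0), because a limit of Hurwitz matrices
   has its spectrum in Re z <= 0, and because the gain condition excludes imaginary
   eigenvalues of H + c X S.  Conversely, if X > 0 satisfies the inequality strictly then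
   H is Hurwitz and |T_inf(K)| < beta by completion of squares, and X >= X_K, so that
   J_mix(K) <= tr((Q2 + K^T R2 K) X).

   Since S >= Qinf > 0, the X in the lifted set stay bounded when K does, so its
   projection is closed.  It lies in the closure of the epigraph: in the coordinates
   (X, Y) = (X, K X) the inequality is a linear matrix inequality (Schur complement), so
   moving slightly towards a strictly feasible point gives strict feasibility.

   Positivity of D when H is Hurwitz and H D + D H^T <= 0 is obtained without
   integrals: H D + D H^T is an invertible linear function of D by Cayley-Hamilton, and
   a homotopy H - t I yields some P > 0 with H P + P H^T < 0. *)
Require Import Defs.
From HB Require Import structures.
From mathcomp Require Import all_boot all_order all_algebra.
From mathcomp Require Import all_classical all_reals all_analysis.
From mathcomp Require Import perm complex.
From mathcomp Require Import ring lra.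
Import Order.TTheory GRing.Theory Num.Theory.
Import numFieldNormedType.Exports.
Local Open Scope ring_scope.
Local Open Scope classical_set_scope.
Set Implicit Arguments.
Unset Strict Implicit.
Unset Printing Implicit Defensive.


(** * Bilinear and quadratic forms, definiteness, and norm bounds for matrices *)

Definition bilf {R : pzRingType} {p q : nat} (M : 'M[R]_(p, q)) (x : 'cV[R]_p)
  (y : 'cV[R]_q) : R := (x^T *m M *m y) 0 0.
Local Notation qform M x := (bilf M x x).
Local Notation sqn x := (bilf 1%:M x x).

Section QuadraticForms.
Context {R : realType}.

Lemma bilfDm p q (M N : 'M[R]_(p, q)) x y : bilf (M + N) x y = bilf M x y + bilf N x y.
Proof. by rewrite /bilf mulmxDr mulmxDl mxE. Qed.
Lemma bilfNm p q (M : 'M[R]_(p, q)) x y : bilf (- M) x y = - bilf M x y.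
Proof. by rewrite /bilf mulmxN mulNmx mxE. Qed.
Lemma bilfZm p q c (M : 'M[R]_(p, q)) x y : bilf (c *: M) x y = c * bilf M x y.
Proof. by rewrite /bilf -scalemxAr -scalemxAl mxE. Qed.
Lemma bilf0m p q x y : bilf (0 : 'M[R]_(p, q)) x y = 0.
Proof. by rewrite /bilf mulmx0 mul0mx mxE. Qed.
Lemma bilfDl p q (M : 'M[R]_(p, q)) x x' y : bilf M (x + x') y = bilf M x y + bilf M x' y.
Proof. by rewrite /bilf linearD /= !mulmxDl mxE. Qed.
Lemma bilfDr p q (M : 'M[R]_(p, q)) x y y' : bilf M x (y + y') = bilf M x y + bilf M x y'.
Proof. by rewrite /bilf mulmxDr mxE. Qed.
Lemma bilfZl p q (M : 'M[R]_(p, q)) c x y : bilf M (c *: x) y = c * bilf M x y.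
Proof. by rewrite /bilf linearZ /= -!scalemxAl mxE. Qed.
Lemma bilfZr p q (M : 'M[R]_(p, q)) c x y : bilf M x (c *: y) = c * bilf M x y.
Proof. by rewrite /bilf -scalemxAr mxE. Qed.
Lemma bilf0l p q (M : 'M[R]_(p, q)) y : bilf M 0 y = 0.
Proof. by rewrite /bilf trmx0 !mul0mx mxE. Qed.
Lemma bilf0r p q (M : 'M[R]_(p, q)) x : bilf M x 0 = 0.
Proof. by rewrite /bilf mulmx0 mxE. Qed.
Lemma bilf_tr p q (M : 'M[R]_(p, q)) x y : bilf M^T y x = bilf M x y.
Proof.
have -> : bilf M x y = (x^T *m M *m y)^T 0 0 by rewrite mxE.
by rewrite !trmx_mul trmxK mulmxA.
Qed.
Lemma bilf_sym p (M : 'M[R]_p) x y : Defs.symmetric M -> bilf M x y = bilf M y x.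
Proof. by move=> sM; rewrite -[RHS]bilf_tr sM. Qed.
Lemma bilf_mul p q r s (M : 'M[R]_(p, q)) (N : 'M[R]_(r, p)) (L : 'M[R]_(q, s)) x y :
  bilf (N *m M *m L) x y = bilf M (N^T *m x) (L *m y).
Proof. by rewrite /bilf trmx_mul trmxK !mulmxA. Qed.
Lemma bilf_mull p q r (M : 'M[R]_(p, q)) (N : 'M[R]_(r, p)) x y :
  bilf (N *m M) x y = bilf M (N^T *m x) y.
Proof. by rewrite -[N *m M]mulmx1 bilf_mul mul1mx. Qed.
Lemma bilf_mulr p q s (M : 'M[R]_(p, q)) (L : 'M[R]_(q, s)) x y :
  bilf (M *m L) x y = bilf M x (L *m y).
Proof. by rewrite -[M in LHS]mul1mx bilf_mul trmx1 mul1mx. Qed.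

Lemma bilfE p q (M : 'M[R]_(p, q)) x y :
  bilf M x y = \sum_i \sum_j x i 0 * M i j * y j 0.
Proof.
rewrite /bilf mxE; under eq_bigr do rewrite mxE big_distrl /=.
rewrite exchange_big; apply: eq_bigr => i _; apply: eq_bigr => j _.
by rewrite !mxE.
Qed.

Lemma sqnE p (x : 'cV[R]_p) : sqn x = \sum_i x i 0 ^+ 2.
Proof. by rewrite /bilf mulmx1 mxE; apply: eq_bigr => i _; rewrite mxE expr2. Qed.

Lemma sqn_ge0 p (x : 'cV[R]_p) : 0 <= sqn x.
Proof. by rewrite sqnE; apply: sumr_ge0 => i _; apply: sqr_ge0. Qed.

Lemma sqn_eq0 p (x : 'cV[R]_p) : (sqn x == 0) = (x == 0).
Proof.
apply/eqP/eqP => [|->]; last by rewrite bilf0l.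
rewrite sqnE => /eqP; rewrite psumr_eq0 => [/allP h|i _]; last exact: sqr_ge0.
apply/colP => i; rewrite mxE.
have := h i (mem_index_enum _); rewrite sqrf_eq0 => /eqP.
by [].
Qed.

Lemma sqn_gt0 p (x : 'cV[R]_p) : (0 < sqn x) = (x != 0).
Proof. by rewrite lt_neqAle sqn_ge0 andbT eq_sym sqn_eq0. Qed.

Lemma sqnT_mul p q (M : 'M[R]_(p, q)) x : sqn (M *m x) = qform (M^T *m M) x.
Proof. by rewrite -[M^T]mulmx1 bilf_mul trmxK. Qed.

Lemma posdef_psd p (M : 'M[R]_p) : posdef M -> possemidef M.
Proof.
case=> sM h; split=> // x; have [->|x0] := eqVneq x 0; last exact/ltW/h.
by rewrite -/(bilf _ _ _) bilf0l.
Qed.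

Lemma psd_ge0 p (M : 'M[R]_p) x : possemidef M -> 0 <= qform M x.
Proof. by case=> _; exact. Qed.

Lemma posdef_gt0 p (M : 'M[R]_p) x : posdef M -> x != 0 -> 0 < qform M x.
Proof. by case=> _; exact. Qed.

Lemma nsd_le0 p (M : 'M[R]_p) x : negsemidef M -> qform M x <= 0.
Proof. by case=> _; exact. Qed.

Lemma symmetricD p (M N : 'M[R]_p) : Defs.symmetric M -> Defs.symmetric N -> Defs.symmetric (M + N).
Proof. by rewrite /Defs.symmetric linearD /= => -> ->. Qed.
Lemma symmetricZ p c (M : 'M[R]_p) : Defs.symmetric M -> Defs.symmetric (c *: M).
Proof. by rewrite /Defs.symmetric linearZ /= => ->. Qed.
Lemma symmetricN p (M : 'M[R]_p) : Defs.symmetric M -> Defs.symmetric (- M).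
Proof. by rewrite /Defs.symmetric linearN /= => ->. Qed.
Lemma symmetric1 p : Defs.symmetric (1%:M : 'M[R]_p).
Proof. exact: trmx1. Qed.
Lemma symmetric_conj p q (M : 'M[R]_p) (N : 'M[R]_(q, p)) : Defs.symmetric M -> Defs.symmetric (N *m M *m N^T).
Proof. by rewrite /Defs.symmetric !trmx_mul trmxK => ->; rewrite mulmxA. Qed.

Lemma psdD p (M N : 'M[R]_p) : possemidef M -> possemidef N -> possemidef (M + N).
Proof.
move=> hM hN; split; first by apply: symmetricD; [case: hM|case: hN].
by move=> x; rewrite -/(bilf _ _ _) bilfDm addr_ge0 // psd_ge0.
Qed.

Lemma psdZ p c (M : 'M[R]_p) : 0 <= c -> possemidef M -> possemidef (c *: M).
Proof.
move=> c0 hM; split; first by apply: symmetricZ; case: hM.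
by move=> x; rewrite -/(bilf _ _ _) bilfZm mulr_ge0 // psd_ge0.
Qed.

Lemma psd_conj p q (M : 'M[R]_p) (N : 'M[R]_(q, p)) :
  possemidef M -> possemidef (N *m M *m N^T).
Proof.
move=> hM; split; first by apply: symmetric_conj; case: hM.
by move=> x; rewrite -/(bilf _ _ _) bilf_mul psd_ge0.
Qed.

Lemma psd_gram p q (N : 'M[R]_(q, p)) : possemidef (N *m N^T).
Proof.
rewrite -[N in N *m _]mulmx1; apply: psd_conj; split; first exact: symmetric1.
by move=> x; rewrite -/(bilf _ _ _) sqn_ge0.
Qed.

(* nonnegative discriminant of [t |-> qform M (x + t y)] *)
Lemma psd_cauchy_schwarz p (M : 'M[R]_p) x y : possemidef M ->
  bilf M x y ^+ 2 <= qform M x * qform M y.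
Proof.
move=> hM; have sM : Defs.symmetric M by case: hM.
have h t s : 0 <= t ^+ 2 * qform M x + 2 * (t * s) * bilf M x y + s ^+ 2 * qform M y.
  have := psd_ge0 (t *: x + s *: y) hM.
  rewrite bilfDl !bilfDr !bilfZl !bilfZr (bilf_sym y x sM); congr (_ <= _); ring.
have := psd_ge0 y hM; rewrite le_eqVlt => /orP[/eqP q0|q0].
  have [->|b0] := eqVneq (bilf M x y) 0.
    by rewrite expr0n /= mulr_ge0 // psd_ge0.
  (* When y is isotropic, the form at x + s y is affine in s; this s makes it equal to -1. *)
  have := h 1 (- (1 + qform M x) / (2 * bilf M x y)); rewrite -q0 mulr0 addr0 => h'.
  exfalso; move: h'.
  have -> : 2 * (1 * (- (1 + qform M x) / (2 * bilf M x y))) * bilf M x y =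
     - (1 + qform M x) by field.
  by lra.
have := h (qform M y) (- bilf M x y).
rewrite (_ : _ + _ = qform M y * (qform M x * qform M y - bilf M x y ^+ 2)); last by ring.
by rewrite pmulr_rge0 // subr_ge0.
Qed.

(** Cauchy-Schwarz for the form of M at x and M x bounds |M x|^4 by a multiple of [qform M x]. *)
Lemma psd_ker p (M : 'M[R]_p) x : possemidef M -> qform M x = 0 -> M *m x = 0.
Proof.
move=> hM q0; apply/eqP; rewrite -sqn_eq0 -sqrf_eq0.
have -> : sqn (M *m x) = bilf M x (M *m x).
  by rewrite sqnT_mul; case: hM => -> _; rewrite bilf_mulr.
by rewrite eq_le sqr_ge0 andbT (le_trans (psd_cauchy_schwarz _ _ hM)) // q0 mul0r.
Qed.

Lemma posdef_unit p (M : 'M[R]_p) : posdef M -> M \in unitmx.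
Proof.
move=> hM; rewrite -unitmx_tr -row_free_unit; apply/inj_row_free => v /(congr1 trmx).
rewrite trmx_mul trmxK trmx0 => h.
have [v0|v0] := eqVneq v^T 0; first by rewrite -[v]trmxK v0 trmx0.
by have := posdef_gt0 hM v0; rewrite /bilf -mulmxA h mulmx0 mxE ltxx.
Qed.

(** By [psd_ker], a vector on which the form vanishes lies in the kernel. Definiteness is thus
    reduced to excluding kernel vectors. *)
Lemma posdef_psd_unit p (M : 'M[R]_p) : possemidef M ->
  (forall x : 'cV_p, M *m x = 0 -> x = 0) -> posdef M.
Proof.
move=> hM h; split; first by case: hM.
move=> x x0; rewrite lt_neqAle -/(bilf _ _ _) psd_ge0 // andbT eq_sym.
by apply: contra_neq x0 => /(psd_ker hM)/h.
Qed.

Lemma mx_entry_le p q (M : 'M[R]_(p, q)) i j : `|M i j| <= `|M|.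
Proof.
rewrite [leRHS]/Num.norm /= mx_normrE.
by apply: (le_bigmax _ (fun ij : 'I_p * 'I_q => `|M ij.1 ij.2|) (i, j)).
Qed.

Lemma mx_norm_le p q (M : 'M[R]_(p, q)) (r : R) : 0 <= r ->
  (forall i j, `|M i j| <= r) -> `|M| <= r.
Proof.
move=> r0 h; rewrite [leLHS]/Num.norm /= mx_normrE.
by apply/bigmax_leP; split=> // -[i j] _; exact: h.
Qed.

(** The norm is the largest absolute entry, so a product costs a factor equal to the inner
    dimension. *)
Lemma mx_norm_mul p q r (M : 'M[R]_(p, q)) (N : 'M[R]_(q, r)) :
  `|M *m N| <= q%:R * (`|M| * `|N|).
Proof.
apply: mx_norm_le => [|i j]; first by rewrite !mulr_ge0.
rewrite mxE (le_trans (ler_norm_sum _ _ _)) //.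
apply: (le_trans (y := \sum_(k < q) `|M| * `|N|)).
  by apply: ler_sum => k _; rewrite normrM ler_pM // mx_entry_le.
by rewrite sumr_const card_ord -[leLHS]mulr_natl.
Qed.

Lemma mx_norm_tr p q (M : 'M[R]_(p, q)) : `|M^T| = `|M|.
Proof.
suff h r s (N : 'M[R]_(r, s)) : `|N^T| <= `|N|.
  by apply/eqP; rewrite eq_le h -{1}[M]trmxK h.
by apply: mx_norm_le => // i j; rewrite mxE mx_entry_le.
Qed.

Lemma qform_bound p (M : 'M[R]_p) x : `|qform M x| <= p%:R * `|M| * sqn x.
Proof.
rewrite bilfE; apply: le_trans (ler_norm_sum _ _ _) _.
apply: (le_trans (y := \sum_i \sum_j `|M| * ((x i 0 ^+ 2 + x j 0 ^+ 2) / 2))).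
  apply: ler_sum => i _; apply: le_trans (ler_norm_sum _ _ _) _.
  apply: ler_sum => j _; rewrite mulrAC mulrC !normrM ler_pM ?mulr_ge0 //.
    exact: mx_entry_le.
  rewrite -[x i 0 ^+ 2]real_normK ?num_real // -[x j 0 ^+ 2]real_normK ?num_real //.
  by have := sqr_ge0 (`|x i 0| - `|x j 0|); lra.
under eq_bigr do rewrite -mulr_sumr.
rewrite -mulr_sumr [p%:R * _]mulrC -mulrA ler_wpM2l // sqnE.
under eq_bigr do under eq_bigr do rewrite mulrDl.
under eq_bigr do rewrite big_split /= sumr_const card_ord -!mulr_suml.
rewrite big_split /= sumrMnl sumr_const card_ord -!mulr_suml.
by rewrite -mulrnDl -splitr mulr_natl.
Qed.

Lemma qform_le p (M : 'M[R]_p) x : qform M x <= p%:R * `|M| * sqn x.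
Proof. exact: le_trans (ler_norm _) (qform_bound _ _). Qed.

(* [|x|^4 = (x^T M M^-1 x)^2 <= (x^T M x) (x^T M^-1 x)] *)
Lemma posdef_lower_bound p (M : 'M[R]_p) : posdef M ->
  exists2 e, 0 < e & forall x, e * sqn x <= qform M x.
Proof.
move=> hM; have uM := posdef_unit hM; have sM : Defs.symmetric M by case: hM.
(* The summand 1 keeps [c] positive even if the norm or the dimension is zero; the same device
   recurs below. *)
set c := 1 + p%:R * `|invmx M|.
have c0 : 0 < c by rewrite ltr_wpDr // mulr_ge0.
exists c^-1; first by rewrite invr_gt0.
move=> x; have [->|x0] := eqVneq x 0; first by rewrite !bilf0l mulr0.
have := psd_cauchy_schwarz x (invmx M *m x) (posdef_psd hM).
rewrite -!bilf_mulr mulmxV // (bilf_sym (invmx M *m x) x (symmetric1 _)) -bilf_mulr mul1mx.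
move=> h; have x1 : 0 < sqn x by rewrite sqn_gt0.
rewrite mulrC ler_pdivrMr //.
have h1 : qform (invmx M) x <= c * sqn x.
  by apply: le_trans (qform_le _ _) _; rewrite /c mulrDl mul1r ler_wpDl // ltW.
have h2 := posdef_gt0 hM x0.
have : sqn x ^+ 2 <= qform M x * (c * sqn x) by apply: le_trans h _; rewrite ler_pM2l.
by rewrite expr2 mulrA ler_pM2r.
Qed.

(* Eliminate the rows of P one at a time, subtracting a rank-one Schur term. *)
Lemma psd_mxtrace_mul_ge0 p (P D : 'M[R]_p) : possemidef P -> possemidef D ->
  0 <= \tr (P *m D).
Proof.
move=> hP hD.
suff : forall k, forall P : 'M[R]_p, possemidef P ->
    (forall i : 'I_p, (k <= i)%N -> P *m delta_mx i (0 : 'I_1) = 0) -> 0 <= \tr (P *m D).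
  by move=> /(_ p P hP); apply=> i; rewrite leqNgt ltn_ord.
move=> {hP P} k; elim: k => [|k IH] P hP hk.
  suff -> : P = 0 by rewrite mul0mx mxtrace0.
  by apply/matrixP => i j; have /colP/(_ i) := hk j (leq0n _); rewrite -colE !mxE.
have [kp|pk] := ltnP k p; last first.
  by apply: IH => // i ki; have := ltn_ord i; rewrite ltnNge (leq_trans pk).
pose j := Ordinal kp; pose e : 'cV[R]_p := delta_mx j 0.
have hj (i : 'I_p) : (k <= i)%N -> i = j \/ (k < i)%N.
  by rewrite leq_eqVlt => /orP[/eqP ki|]; [left; apply/val_inj|right].
have := psd_ge0 e hP; rewrite le_eqVlt => /orP[/eqP/esym/(psd_ker hP) e0|e0].
  by apply: IH => // i /hj[->//|]; exact: hk.
set a := qform P e in e0; pose v := P *m e.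
have sP : P^T = P by case: hP.
have Ev x : v^T *m x = (bilf P e x)%:M.
  by rewrite [LHS]mx11_scalar /v trmx_mul sP.
have hP' : possemidef (P - a^-1 *: (v *m v^T)).
  split; first by rewrite /Defs.symmetric linearB /= linearZ /= trmx_mul trmxK sP.
  move=> x; rewrite -/(bilf _ _ _) bilfDm bilfNm bilfZm bilf_mulr Ev.
  have -> : bilf v x (bilf P e x)%:M = bilf P e x ^+ 2.
    rewrite -[_%:M]mulmx1 mul_scalar_mx bilfZr expr2; congr (_ * _).
    by rewrite /bilf /v mulmx1 mulmxA -/(bilf _ _ _) bilf_sym.
  by rewrite subr_ge0 mulrC ler_pdivrMr // mulrC psd_cauchy_schwarz.
have -> : P = (P - a^-1 *: (v *m v^T)) + a^-1 *: (v *m v^T) by rewrite subrK.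
rewrite mulmxDl linearD /= addr_ge0 //.
  apply: IH => // i /hj[->|ki]; rewrite mulmxBl -scalemxAl -mulmxA Ev.
    by rewrite mul_mx_scalar scalerA mulVf ?gt_eqF // scale1r subrr.
  by rewrite /bilf -mulmxA (hk _ ki) mulmx0 mxE -scalemx1 scale0r mulmx0 scaler0 subr0.
rewrite -scalemxAl linearZ /= mulr_ge0 ?invr_ge0 ?(ltW e0) //.
rewrite -mulmxA mxtrace_mulC /mxtrace big_ord1 -mulmxA mulmxA.
exact: (psd_ge0 v hD).
Qed.

End QuadraticForms.

(** * Hurwitz matrices, the Lyapunov operator and Lyapunov certificates *)

Local Notation mRe := (map_mx (@complex.Re _)).
Local Notation mIm := (map_mx (@complex.Im _)).
Local Notation Re := complex.Re.
Local Notation Im := complex.Im.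

Section Lyapunov.
Context {R : realType}.
Implicit Types z : R[i].

Lemma cmxE p q (M : 'M[R]_(p, q)) : cmx M = map_mx (real_complex R) M.
Proof. by []. Qed.

Lemma cmxM p q r (M : 'M[R]_(p, q)) (N : 'M[R]_(q, r)) :
  cmx (M *m N) = cmx M *m cmx N.
Proof. by rewrite !cmxE map_mxM. Qed.

Lemma ReD z w : Re (z + w) = Re z + Re w. Proof. by case: z; case: w. Qed.
Lemma ImD z w : Im (z + w) = Im z + Im w. Proof. by case: z; case: w. Qed.
Lemma ReM z w : Re (z * w) = Re z * Re w - Im z * Im w.
Proof. by case: z; case: w. Qed.
Lemma ImM z w : Im (z * w) = Re z * Im w + Im z * Re w.
Proof. by case: z; case: w => a b c d /=; rewrite addrC. Qed.

Lemma mRe_mul p q r (M : 'M[R[i]]_(p, q)) (N : 'M[R[i]]_(q, r)) :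
  mRe (M *m N) = mRe M *m mRe N - mIm M *m mIm N.
Proof.
apply/matrixP => i j; rewrite !mxE -sumrB (big_morph _ ReD (erefl (Re 0))).
by apply: eq_bigr => k _; rewrite ReM !mxE.
Qed.

Lemma mIm_mul p q r (M : 'M[R[i]]_(p, q)) (N : 'M[R[i]]_(q, r)) :
  mIm (M *m N) = mRe M *m mIm N + mIm M *m mRe N.
Proof.
apply/matrixP => i j; rewrite !mxE -big_split (big_morph _ ImD (erefl (Im 0))).
by apply: eq_bigr => k _; rewrite ImM !mxE.
Qed.

Lemma mRe_cmx p q (M : 'M[R]_(p, q)) : mRe (cmx M) = M.
Proof. by apply/matrixP => i j; rewrite !mxE. Qed.
Lemma mIm_cmx p q (M : 'M[R]_(p, q)) : mIm (cmx M) = 0.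
Proof. by apply/matrixP => i j; rewrite !mxE. Qed.
Lemma mRe_mulc p q r (M : 'M[R[i]]_(p, q)) (N : 'M[R]_(q, r)) :
  mRe (M *m cmx N) = mRe M *m N.
Proof. by rewrite mRe_mul mRe_cmx mIm_cmx mulmx0 subr0. Qed.
Lemma mIm_mulc p q r (M : 'M[R[i]]_(p, q)) (N : 'M[R]_(q, r)) :
  mIm (M *m cmx N) = mIm M *m N.
Proof. by rewrite mIm_mul mRe_cmx mIm_cmx mulmx0 add0r. Qed.
Lemma mRe_scale p q z (M : 'M[R[i]]_(p, q)) :
  mRe (z *: M) = Re z *: mRe M - Im z *: mIm M.
Proof. by apply/matrixP => i j; rewrite !mxE ReM. Qed.
Lemma mIm_scale p q z (M : 'M[R[i]]_(p, q)) :
  mIm (z *: M) = Re z *: mIm M + Im z *: mRe M.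
Proof. by apply/matrixP => i j; rewrite !mxE ImM. Qed.

Lemma mReIm_eq0 p q (M : 'M[R[i]]_(p, q)) : mRe M = 0 -> mIm M = 0 -> M = 0.
Proof.
move=> /matrixP h1 /matrixP h2; apply/matrixP => i j.
have := h1 i j; have := h2 i j; rewrite !mxE.
by case: (M i j) => a b /= -> ->.
Qed.

(** Trades the spectrum for invertibility on the closed right half plane, the form in which
    stability enters resolvents and the Cayley-Hamilton argument. *)
Lemma Hurwitz_unitP p (A : 'M[R]_p) :
  Hurwitz A <-> forall z, 0 <= Re z -> cmx A - z%:M \in unitmx.
Proof.
have key z : cmx A - z%:M \in unitmx = ~~ eigenvalue (cmx A) z.
  by rewrite -row_free_unit -kermx_eq0 /eigenvalue negbK.
split=> h z.
  by rewrite key; apply: contraTN => /h; rewrite ltNge.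
by move=> ez; rewrite ltNge; apply/negP => /h; rewrite key ez.
Qed.

(** Eigenvectors are rows here. Transposing their real and imaginary parts gives columns acted on by
    A^T, which is what [qform_lyap] consumes. *)
Lemma eigenvalue_real_pair p (A : 'M[R]_p) z : eigenvalue (cmx A) z ->
  exists x y : 'cV[R]_p, [/\ (x != 0) || (y != 0),
    A^T *m x = Re z *: x - Im z *: y & A^T *m y = Re z *: y + Im z *: x].
Proof.
move=> /eigenvalueP[u uA u0]; exists (mRe u)^T, (mIm u)^T; split.
- apply: contra_neqT u0; rewrite negb_or !negbK => /andP[/eqP h1 /eqP h2].
  by apply: mReIm_eq0; [rewrite -[mRe u]trmxK h1|rewrite -[mIm u]trmxK h2]; rewrite trmx0.
- by rewrite -trmx_mul -mRe_mulc uA mRe_scale linearB /= !linearZ.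
- by rewrite -trmx_mul -mIm_mulc uA mIm_scale linearD /= !linearZ.
Qed.

Lemma Hurwitz_shift p (A : 'M[R]_p) (t : R) : Hurwitz A -> 0 <= t -> Hurwitz (A - t%:M).
Proof.
move=> /Hurwitz_unitP h t0; apply/Hurwitz_unitP => z z0.
have -> : cmx (A - t%:M) - z%:M = cmx A - (real_complex R t + z)%:M.
  by rewrite !cmxE map_mxB map_scalar_mx /= [X in _ = _ - X]raddfD opprD addrA.
by apply: h; rewrite ReD /= addr_ge0.
Qed.

Definition lyap p (H D : 'M[R]_p) : 'M[R]_p := H *m D + D *m H^T.

Lemma lyapD p (H D E : 'M[R]_p) : lyap H (D + E) = lyap H D + lyap H E.
Proof. by rewrite /lyap mulmxDr mulmxDl addrACA. Qed.
Lemma lyapZ p c (H D : 'M[R]_p) : lyap H (c *: D) = c *: lyap H D.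
Proof. by rewrite /lyap -scalemxAr -scalemxAl scalerDr. Qed.
Lemma lyapN p (H D : 'M[R]_p) : lyap H (- D) = - lyap H D.
Proof. by rewrite -scaleN1r lyapZ scaleN1r. Qed.
Lemma lyap_addl p (H G D : 'M[R]_p) : lyap (H + G) D = lyap H D + lyap G D.
Proof. by rewrite /lyap linearD /= mulmxDl mulmxDr addrACA. Qed.
Lemma lyap_shift p (H D : 'M[R]_p) t : lyap (H - t%:M) D = lyap H D - (2 * t) *: D.
Proof.
rewrite lyap_addl; congr (_ + _); rewrite /lyap linearN /= tr_scalar_mx.
by rewrite mulNmx mulmxN mul_scalar_mx mul_mx_scalar -opprD -scalerDl mulrDl mul1r.
Qed.
Lemma lyap_tr p (H D : 'M[R]_p) : (lyap H D)^T = lyap H D^T.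
Proof. by rewrite /lyap linearD /= !trmx_mul trmxK addrC. Qed.
Lemma lyap_sym p (H D : 'M[R]_p) : Defs.symmetric D -> Defs.symmetric (lyap H D).
Proof. by move=> sD; rewrite /Defs.symmetric lyap_tr sD. Qed.
Lemma qform_lyap p (H D : 'M[R]_p) x : Defs.symmetric D ->
  qform (lyap H D) x = 2 * bilf D x (H^T *m x).
Proof.
move=> sD; rewrite /lyap. rewrite bilfDm bilf_mull bilf_mulr (bilf_sym _ x sD); ring.
Qed.

(** Drives the kernel arguments: at a kernel vector of D the Lyapunov form cannot have a strict
    sign. *)
Lemma qform_lyap_ker p (H D : 'M[R]_p) x : Defs.symmetric D -> D *m x = 0 ->
  qform (lyap H D) x = 0.
Proof.
move=> sD Dx; rewrite qform_lyap // -bilf_tr sD -[D]mul1mx bilf_mulr.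
by rewrite Dx bilf0r mulr0.
Qed.

(* H D = D (-H^T) gives p(H) D = D p(-H^T) with p the characteristic polynomial of H. *)
Lemma lyap_inj p (H D : 'M[R]_p) : Hurwitz H -> lyap H D = 0 -> D = 0.
Proof.
case: p H D => [|p] H D hH e; first by apply/matrixP => -[].
set HC := cmx H; set G := - HC^T.
have comm : HC *m cmx D = cmx D *m G.
  have : H *m D = - (D *m H^T) by apply/eqP; rewrite -addr_eq0; apply/eqP.
  by move=> /(congr1 cmx); rewrite cmxM => ->; rewrite /G map_trmx !cmxE map_mxN map_mxM mulmxN.
have [r Dr] := closed_field_poly_normal (char_poly HC).
rewrite (monicP (char_poly_monic HC)) scale1r in Dr.
have CH := Cayley_Hamilton HC; rewrite Dr rmorph_prod /= in CH.
have step s : (\prod_(z <- s) horner_mx HC ('X - z%:P)) *m cmx D =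
    cmx D *m (\prod_(z <- s) (G - z%:M)).
  elim: s => [|z s IH]; first by rewrite !big_nil mul1mx mulmx1.
  rewrite !big_cons -!mulmxE -mulmxA IH !mulmxA; congr (_ *m _).
  rewrite rmorphB /= horner_mx_X horner_mx_C mulmxBl mulmxBr comm.
  by rewrite mul_scalar_mx mul_mx_scalar.
have := step r; rewrite CH mul0mx => /esym h.
(* Each root z has Re z < 0, so -z lies in the right half plane where H + z is invertible; hence
   every factor of p(-H^T) is invertible. *)
have U : \prod_(z <- r) (G - z%:M) \in unitmx.
  rewrite -[_ \in unitmx]/(_ \is a GRing.unit).
  rewrite big_seq; apply: rpred_prod => z zr.
  have ez : eigenvalue HC z by rewrite eigenvalue_root_char Dr root_prod_XsubC.
  rewrite -[_ \is a GRing.unit]/(_ \in unitmx) -unitmx_tr /G linearB linearN /= trmxK tr_scalar_mx.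
  have -> : - HC - z%:M = - (HC - (- z)%:M).
    apply/matrixP => a b; rewrite !mxE mulNrn; ring.
  have := (Hurwitz_unitP H).1 hH (- z).
  have -> : Re (- z) = - Re z by case: (z).
  rewrite oppr_ge0 (ltW (hH _ ez)) => /(_ isT).
  by rewrite -![_ \in unitmx]/(_ \is a GRing.unit) unitrN.
have : cmx D = 0 by rewrite -[cmx D]mulmx1 -(mulmxV U) mulmxA h mul0mx.
by move/matrixP => D0; apply/matrixP => i j; have := D0 i j; rewrite !mxE => -[].
Qed.

Lemma mxvec_norm p q (M : 'M[R]_(p, q)) : `|mxvec M| <= `|M|.
Proof.
apply: mx_norm_le => // i j; rewrite ord1.
by case/mxvec_indexP: j => a b; rewrite mxvecE mx_entry_le.
Qed.

Lemma vec_mx_norm p q (v : 'rV[R]_(p * q)) : `|vec_mx v| <= `|v|.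
Proof. by apply: mx_norm_le => // i j; rewrite mxE mx_entry_le. Qed.

(** After vectorisation the Lyapunov operator is a square matrix T, so [lyap_inj] makes it
    invertible, and the norm of its inverse gives the bound l. *)
Lemma lyap_solve p (H : 'M[R]_p) : Hurwitz H ->
  exists L : 'M[R]_p -> 'M[R]_p, exists2 l, 0 < l &
    forall M, lyap H (L M) = M /\ `|L M| <= l * `|M|.
Proof.
move=> hH; pose T : 'M[R]_(p * p) := lin_mulmx H + lin_mulmxr H^T.
have TE D : mxvec D *m T = mxvec (lyap H D).
  by rewrite /T mulmxDr !mul_vec_lin /= -linearD.
have uT : T \in unitmx.
  rewrite -row_free_unit; apply/inj_row_free => v.
  rewrite -[v]vec_mxK TE => h.
  have -> : vec_mx v = 0; last by rewrite linear0.
  by apply: (lyap_inj hH); rewrite -[LHS]mxvecK h linear0.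
exists (fun M => vec_mx (mxvec M *m invmx T)), (1 + (p * p)%:R * `|invmx T|).
  by rewrite ltr_wpDr // mulr_ge0.
move=> M; split.
  by apply: (can_inj mxvecK); rewrite -TE vec_mxK -mulmxA mulVmx // mulmx1.
apply: le_trans (vec_mx_norm _) _; apply: le_trans (mx_norm_mul _ _) _.
rewrite mulrDl mul1r ler_wpDl // -[leRHS]mulrA ler_wpM2l // mulrC ler_wpM2l //.
exact: mxvec_norm.
Qed.

(** Supplies the extremal parameter of the two homotopy arguments below, without claiming that it is
    attained. *)
Lemma inf_ge0_spec (E : set R) : (exists t, E t) -> (forall t, E t -> 0 <= t) ->
  exists s, [/\ 0 <= s, forall t, E t -> s <= t &
    forall h, 0 < h -> exists2 t, E t & t < s + h].
Proof.
move=> E0 Epos; have hE : has_inf E by split=> //; exists 0 => t /Epos.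
exists (inf E); split.
- by apply: lb_le_inf => //; case: hE.
- by move=> t Et; apply: ge_inf => //; case: hE.
- by move=> h h0; have [t] := inf_adherent h0 hE; exists t.
Qed.

(** A quadratic Lyapunov function for H^T. Its existence is equivalent to H being Hurwitz, by
    [lyap_cert_Hurwitz] and [Hurwitz_lyap_cert]. *)
Definition lyap_cert p (H P : 'M[R]_p) := posdef P /\ posdef (- lyap H P).

Lemma posdef_psdD p (M N : 'M[R]_p) : posdef M -> possemidef N -> posdef (M + N).
Proof.
move=> hM hN; split; first by apply: symmetricD; [case: hM|case: hN].
by move=> x x0; rewrite -/(bilf _ _ _) bilfDm ltr_wpDr ?psd_ge0 // posdef_gt0.
Qed.

Lemma posdefZ p c (M : 'M[R]_p) : 0 < c -> posdef M -> posdef (c *: M).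
Proof.
move=> c0 hM; split; first by apply: symmetricZ; case: hM.
by move=> x x0; rewrite -/(bilf _ _ _) bilfZm mulr_gt0 // posdef_gt0.
Qed.

Lemma posdef1 p : posdef (1%:M : 'M[R]_p).
Proof. by split=> [|x]; rewrite -/(bilf _ _ _) ?sqn_gt0 //; exact: symmetric1. Qed.

(** M has a margin e |x|^2, and for small t of either sign the perturbation consumes at most half of
    it. *)
Lemma posdef_perturb p (M N : 'M[R]_p) : posdef M -> Defs.symmetric N ->
  exists2 h, 0 < h & forall t, `|t| <= h -> posdef (M + t *: N).
Proof.
move=> hM sN; have [e e0 he] := posdef_lower_bound hM.
set c := 1 + p%:R * `|N|.
have c0 : 0 < c by rewrite ltr_wpDr // mulr_ge0.
exists (e / (2 * c)); first by rewrite divr_gt0 ?mulr_gt0.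
move=> t ht; split; first by apply: symmetricD; [case: hM|exact: symmetricZ].
move=> x x0; rewrite -/(bilf _ _ _) bilfDm bilfZm.
have x1 : 0 < sqn x by rewrite sqn_gt0.
have h1 : `|t * qform N x| <= e / 2 * sqn x.
  rewrite normrM; apply: (le_trans (y := e / (2 * c) * (c * sqn x))).
    apply: ler_pM => //; apply: le_trans (qform_bound _ _) _.
    by rewrite ler_wpM2r ?sqn_ge0 // /c ler_wpDl.
  by rewrite le_eqVlt; apply/orP; left; apply/eqP; field; rewrite gt_eqF.
have h2 := he x; have := ler_norm (- (t * qform N x)); rewrite normrN => h3.
have : 0 < e * sqn x by rewrite mulr_gt0.
lra.
Qed.

(* At the least t >= 0 with D + t P >= 0, a kernel vector of D + t P contradicts the strict inequality of P. *)
Lemma lyap_cert_psd p (H P D : 'M[R]_p) : lyap_cert H P -> Defs.symmetric D ->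
  negsemidef (lyap H D) -> possemidef D.
Proof.
move=> [hP hL] sD hD.
pose E := [set t : R | 0 <= t /\ possemidef (D + t *: P)].
have sDP t : Defs.symmetric (D + t *: P).
  by apply: symmetricD => //; apply: symmetricZ; case: hP.
have [s [s0 sE sa]] : exists s, [/\ 0 <= s, forall t, E t -> s <= t &
    forall h, 0 < h -> exists2 t, E t & t < s + h].
  apply: inf_ge0_spec => [|t []//].
  have [e e0 he] := posdef_lower_bound hP.
  exists (p%:R * `|D| / e); split; first by rewrite divr_ge0 ?mulr_ge0 // ltW.
  split=> // x; rewrite -/(bilf _ _ _) bilfDm bilfZm.
  have h1 := qform_bound D x; have h2 := ler_norm (- qform D x); rewrite normrN in h2.
  have : p%:R * `|D| / e * (e * sqn x) <= p%:R * `|D| / e * qform P x.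
    by rewrite ler_wpM2l // divr_ge0 ?mulr_ge0 // ltW.
  rewrite mulrA divfK ?gt_eqF // => h3; lra.
(* Semidefiniteness passes to the infimum: for t in E close to s, the form at x changes by at most
   e. *)
have psdS : possemidef (D + s *: P).
  split=> // x; rewrite -/(bilf _ _ _) bilfDm bilfZm; apply/ler_addgt0Pr => e e0.
  have q0 : 0 < 1 + qform P x by rewrite ltr_wpDr // psd_ge0 //; exact: posdef_psd.
  have [t [t0 /(psd_ge0 x) h] ts] := sa _ (divr_gt0 e0 q0).
  rewrite bilfDm bilfZm in h; apply: le_trans h _.
  rewrite -addrA lerD2l.
  apply: (le_trans (y := (s + e / (1 + qform P x)) * qform P x)).
    by rewrite ler_wpM2r ?psd_ge0 // ?ltW //; exact: posdef_psd.
  rewrite mulrDl lerD2l mulrAC ler_pdivrMr // ler_wpM2l ?ltW //.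
  by rewrite ltrDr.
move: s0; rewrite le_eqVlt => /orP[/eqP s0|s0].
  by move: psdS; rewrite -s0 scale0r addr0.
(* With trivial kernel D + s P is definite, so s could be lowered, against its minimality. *)
have [h|] := pselect (forall x : 'cV[R]_p, (D + s *: P) *m x = 0 -> x = 0).
  have [h1 h10 hh] := posdef_perturb (posdef_psd_unit psdS h) (proj1 hP).
  have /hh : `|- Num.min h1 s| <= h1.
    by rewrite normrN ger0_norm ?ge_min ?lexx // le_min !ltW.
  rewrite -addrA -scalerDl => /posdef_psd h2.
  have := sE (s - Num.min h1 s); rewrite lerBrDr gerDl leNgt lt_min h10 s0 => /(_ _)/negP[] //.
  by split=> //; rewrite subr_ge0 ge_min lexx orbT.
move=> /existsNP[x] /not_implyP[Dx /eqP x0]; exfalso.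
have := qform_lyap_ker H (sDP s) Dx; rewrite lyapD lyapZ bilfDm bilfZm.
have := nsd_le0 x hD; have := posdef_gt0 hL x0; rewrite bilfNm oppr_gt0 => h1 h2 h3.
have : s * qform (lyap H P) x < 0 by rewrite pmulr_rlt0.
lra.
Qed.

Lemma lyap_solve_sym p (H M : 'M[R]_p) : Hurwitz H -> Defs.symmetric M ->
  exists2 D, Defs.symmetric D & lyap H D = M.
Proof.
move=> hH sM; have [L [l _ /(_ M)[hL _]]] := lyap_solve hH.
exists (L M) => //; apply/eqP; rewrite -subr_eq0; apply/eqP; apply: (lyap_inj hH).
by rewrite lyapD lyapN -lyap_tr hL sM subrr.
Qed.

(** Summing the Lyapunov form over the real and imaginary parts x, y of an eigenvector for z cancels
    Im z and leaves 2 Re z (x^T P x + y^T P y), which must be negative. *)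
Lemma lyap_cert_Hurwitz p (H P : 'M[R]_p) : lyap_cert H P -> Hurwitz H.
Proof.
move=> [hP hL] z /eigenvalue_real_pair[x [y [xy0 hx hy]]].
have sP := proj1 hP; have pP := posdef_psd hP; have pL := posdef_psd hL.
have h : qform (lyap H P) x + qform (lyap H P) y = 2 * Re z * (qform P x + qform P y).
  rewrite !qform_lyap // hx hy -scaleNr !(bilfDr, bilfZr) (bilf_sym y x sP); ring.
have : 0 < qform (- lyap H P) x + qform (- lyap H P) y /\ 0 < qform P x + qform P y.
  case/orP: xy0 => n0; split;
  first [by rewrite ltr_wpDr ?psd_ge0 ?posdef_gt0|by rewrite ltr_wpDl ?psd_ge0 ?posdef_gt0].
rewrite !bilfNm -opprD h oppr_gt0 => -[h1 h2].
by move: h1; rewrite pmulr_llt0 // pmulr_rlt0.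
Qed.

(* Homotopy H - t I: at the infimum of the admissible t >= 0, the solution of [lyap (H - t) D = - I] is again a certificate. *)
Lemma Hurwitz_lyap_cert p (H : 'M[R]_p) : Hurwitz H -> exists P, lyap_cert H P.
Proof.
move=> hH; pose E := [set t : R | 0 <= t /\ exists P, lyap_cert (H - t%:M) P].
have Emon t t' : E t -> t <= t' -> E t'.
  move=> [t0 [P [hP hL]]] tt; split; first exact: le_trans tt.
  exists P; split; first exact: hP.
  have -> : - lyap (H - t'%:M) P = - lyap (H - t%:M) P + (2 * (t' - t)) *: P.
    by rewrite !lyap_shift !opprB mulrBr scalerBl [in RHS]addrC !addrA subrK.
  by apply: posdef_psdD => //; apply: psdZ; [rewrite mulr_ge0 ?subr_ge0|exact: posdef_psd].
have [s [s0 sE sa]] : exists s, [/\ 0 <= s, forall t, E t -> s <= t &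
    forall h, 0 < h -> exists2 t, E t & t < s + h].
  apply: inf_ge0_spec => [|t []//].
  have [h h0 hh] := posdef_perturb (posdef1 p) (lyap_sym H (symmetric1 p)).
  (* For this shift the identity is a certificate: h times its negated Lyapunov image is I - h
     [lyap H 1%:M], which is definite by the choice of h. *)
  exists (1 / (2 * h)); split; first by rewrite divr_ge0 ?mulr_ge0 // ltW.
  exists 1%:M; split; first exact: posdef1.
  have -> : - lyap (H - (1 / (2 * h))%:M) 1%:M = h^-1 *: (1%:M + (- h) *: lyap H 1%:M).
    rewrite lyap_shift scalerDr scalerA mulrN mulVf ?gt_eqF // scaleN1r opprB.
    by congr (_ *: _ + _); field; rewrite gt_eqF.
  apply: posdefZ; first by rewrite invr_gt0.
  by apply: hh; rewrite normrN gtr0_norm.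
have hHs := Hurwitz_shift hH s0.
have [D sD eD] := lyap_solve_sym hHs (symmetricN (symmetric1 p)).
have [h h0 hh] := posdef_perturb (posdef1 p) sD.
have lE t : - lyap (H - (s + t)%:M) D = 1%:M + (2 * t) *: D.
  rewrite -[1%:M]opprK -eD !lyap_shift mulrDr scalerDl; apply/esym.
  by apply/matrixP => a b; rewrite !mxE; ring.
(* Some P certifies H - (s + h/2), and there D still has a negative Lyapunov image, namely -(I + h
   D); so [lyap_cert_psd] applies to D. *)
have pD : possemidef D.
  have [t0 [P cP]] : E (s + h / 2).
    have [t Et /ltW] := sa (h / 2) (divr_gt0 h0 (ltr0Sn _ 1)); exact: Emon.
  apply: (lyap_cert_psd cP sD); have : posdef (- lyap (H - (s + h / 2)%:M) D).
    by rewrite lE; apply: hh; rewrite mulrC divfK // gtr0_norm.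
  move=> /posdef_psd [h1 h2]; split; first exact: lyap_sym.
  by move=> x; have := h2 x; rewrite -/(bilf _ _ _) bilfNm oppr_ge0.
have dD : posdef D.
  apply: posdef_psd_unit => // x Dx.
  apply/eqP; rewrite -sqn_eq0 -oppr_eq0; apply/eqP.
  by rewrite -[RHS](qform_lyap_ker (H - s%:M) sD Dx) eD bilfNm.
(* The certificate D survives a small decrease of the shift, so minimality forces s = 0. *)
have Es : E (s - Num.min (h / 2) s).
  split; first by rewrite subr_ge0 ge_min lexx orbT.
  exists D; split=> //; rewrite lE; apply: hh.
  rewrite mulrN normrN ger0_norm; last by rewrite mulr_ge0 // le_min s0 andbT divr_ge0 // ltW.
  by rewrite mulrC -ler_pdivlMr // ge_min lexx.
have : Num.min (h / 2) s <= 0 by have := sE _ Es; rewrite lerBrDr gerDl.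
rewrite ge_min leNgt divr_gt0 //= => ss.
have s1 : s = 0 by apply/le_anti; rewrite ss s0.
by exists D; split=> //; have := lE 0; rewrite addr0 mulr0 scale0r addr0 s1 raddf0 subr0 => ->; exact: posdef1.
Qed.

Lemma Hurwitz_lyap_psd p (H D : 'M[R]_p) : Hurwitz H -> Defs.symmetric D ->
  negsemidef (lyap H D) -> possemidef D.
Proof. by move=> /Hurwitz_lyap_cert[P]; exact: lyap_cert_psd. Qed.

(** A certificate P of H remains one for H + G: the form of [lyap G P] is linear in G and at most
    half of the margin of P. *)
Lemma Hurwitz_open p (H : 'M[R]_p) : Hurwitz H ->
  exists2 e, 0 < e & forall G, `|G| <= e -> Hurwitz (H + G).
Proof.
move=> /Hurwitz_lyap_cert[P [hP hL]].
have [e e0 he] := posdef_lower_bound hL.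
set c := 1 + p%:R * (2 * (p%:R * `|P|)).
have c0 : 0 < c by rewrite ltr_wpDr // !mulr_ge0.
exists (e / (2 * c)); first by rewrite divr_gt0 ?mulr_gt0.
move=> G hG; apply: (lyap_cert_Hurwitz (P := P)); split=> //.
split; first by apply/symmetricN/lyap_sym; case: hP.
move=> x x0; rewrite -/(bilf _ _ _) lyap_addl opprD bilfDm.
have x1 : 0 < sqn x by rewrite sqn_gt0.
have h1 : qform (lyap G P) x <= e / 2 * sqn x.
  apply: le_trans (qform_le _ _) _; rewrite ler_wpM2r ?sqn_ge0 //.
  have : `|lyap G P| <= 2 * (p%:R * (`|G| * `|P|)).
    apply: le_trans (ler_normD _ _) _.
    have := mx_norm_mul G P; have := mx_norm_mul P G^T; rewrite mx_norm_tr [`|P| * _]mulrC; lra.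
  move=> /(ler_wpM2l (ler0n R p)) h; apply: le_trans h _.
  apply: (le_trans (y := `|G| * c)).
    rewrite /c; have := normr_ge0 G; move: (`|G|) (`|P|) (p%:R) => g q r; nra.
  rewrite -ler_pdivlMr //; apply: le_trans hG _.
  by rewrite le_eqVlt; apply/orP; left; apply/eqP; field; rewrite gt_eqF.
have h2 := he x; rewrite !bilfNm in h2 *.
have : 0 < e * sqn x by rewrite mulr_gt0.
lra.
Qed.

End Lyapunov.

(** * A closed condition on the spectrum that survives limits of Hurwitz matrices *)

Section HurwitzLimit.
Context {R : realType}.

(** Equals |det (F - z)|^2 for z = a + i b, written over the reals so that continuity in F is that
    of a real determinant. *)
Definition shift_det p (F : 'M[R]_p) (a b : R) : R :=
  \det ((F - a%:M) *m (F - a%:M) + (b ^+ 2)%:M).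

(* [(F - z) (F - conj z)] with z = a + i b *)
Lemma shift_detE p (F : 'M[R]_p) (a b : R) :
  real_complex R (shift_det F a b) =
  \det (cmx F - (Complex a b)%:M) * \det (cmx F - (Complex a (- b))%:M).
Proof.
rewrite -det_mulmx /shift_det -det_map_mx; congr (\det _).
rewrite map_mxD map_mxM map_mxB !map_scalar_mx /= cmxE.
set G := map_mx _ F.
have e (s : R) : Complex a (s * b) = real_complex R a + Complex 0 (s * b).
  by rewrite /= /GRing.add /= addr0 add0r.
have := e 1; have := e (-1); rewrite mul1r mulN1r => -> ->.
set z := Complex 0 b; have -> : Complex 0 (- b) = - z by rewrite /z /GRing.opp /= oppr0.
have -> : real_complex R (b ^+ 2) = - (z * z).
  by rewrite /z /GRing.mul /GRing.opp /= !mul0r mulr0 sub0r addr0 opprK oppr0 expr2.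
have -> : G - (real_complex R a + z)%:M = (G - (real_complex R a)%:M) - z%:M.
  by rewrite [X in _ - X]raddfD opprD addrA.
have -> : G - (real_complex R a - z)%:M = (G - (real_complex R a)%:M) + z%:M.
  by rewrite [X in _ - X]raddfB opprB [_ - _%:M]addrC addrA addrC.
move: (G - _) => H; rewrite mulmxDr !mulmxBl mul_mx_scalar !mul_scalar_mx scale_scalar_mx.
by rewrite addrA addrNK [X in _ + X]raddfN.
Qed.

(** Factor the characteristic polynomial: each root w has Re w < 0, so |z - w| >= Re (z - w) >=
    a. *)
Lemma Hurwitz_det_norm p (F : 'M[R]_p) (a b : R) : Hurwitz F -> 0 <= a ->
  real_complex R (a ^+ p) <= `|\det (cmx F - (Complex a b)%:M)|.
Proof.
move=> hF a0; set z := Complex a b.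
have -> : `|\det (cmx F - z%:M)| = `|(char_poly (cmx F)).[z]|.
  rewrite -[cmx F - _]opprB -scaleN1r detZ normrM normrX normrN1 expr1n mul1r.
  rewrite -/(horner_eval z _) /char_poly -det_map_mx; congr (`|\det _|).
  apply/matrixP => i j; rewrite /char_poly_mx !mxE /= /horner_eval hornerD hornerN hornerC.
  by rewrite hornerMn hornerX.
have [r Dr] := closed_field_poly_normal (char_poly (cmx F)).
rewrite (monicP (char_poly_monic _)) scale1r in Dr.
have -> : a ^+ p = a ^+ size r.
  congr (_ ^+ _); by have := size_char_poly (cmx F); rewrite Dr size_prod_XsubC => -[].
have hr w : w \in r -> Re w < 0.
  by move=> wr; apply: hF; rewrite eigenvalue_root_char Dr root_prod_XsubC.
rewrite Dr horner_prod normr_prod {Dr}.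
elim: r hr => [|w r IH] hr; first by rewrite big_nil expr0.
rewrite big_cons exprS rmorphM /= ler_pM ?ler0c ?exprn_ge0 //; last first.
  by apply: IH => x xr; apply: hr; rewrite inE xr orbT.
rewrite hornerXsubC.
have hw : Re w < 0 by apply: hr; rewrite inE eqxx.
apply: (le_trans (y := real_complex R (Re (z - w)))).
  by rewrite lecR; case: w hw {hr} => u v /= hu; rewrite lerDl oppr_ge0 ltW.
apply: le_trans (normc_ge_Re _); rewrite lecR; exact: ler_norm.
Qed.

(** The bound is a closed condition on F and, for a > 0, is violated at any eigenvalue a + i b by
    [eigenvalue_shift_det]. It therefore keeps limits free of eigenvalues in the open right half
    plane. *)
Lemma Hurwitz_shift_det p (F : 'M[R]_p) (a b : R) : Hurwitz F -> 0 <= a ->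
  a ^+ p * a ^+ p <= `|shift_det F a b|.
Proof.
move=> hF a0; rewrite -lecR.
have -> : real_complex R `|shift_det F a b| = `|real_complex R (shift_det F a b)|.
  by rewrite normc_def /= expr0n addr0 sqrtr_sqr.
rewrite shift_detE normrM rmorphM /= ler_pM ?ler0c ?exprn_ge0 //; exact: Hurwitz_det_norm.
Qed.

Lemma eigenvalue_shift_det p (F : 'M[R]_p) z : eigenvalue (cmx F) z ->
  shift_det F (Re z) (Im z) = 0.
Proof.
move=> /eigenvalueP[u uF u0]; have := shift_detE F (Re z) (Im z).
have -> : Complex (Re z) (Im z) = z by case: (z).
suff -> : \det (cmx F - z%:M) = 0 by rewrite mul0r => -[].
apply/eqP; apply: contraNT u0; rewrite -unitfE -unitmxE => U.
by rewrite -[u]mulmx1 -(mulmxV U) mulmxA mulmxBr uF mul_mx_scalar subrr mul0mx.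
Qed.

End HurwitzLimit.

(** * Frequency-wise gain of a transfer matrix and its relation to the Riccati inequality *)

Section BoundedReal.
Context {R : realType}.

Definition csqn p (v : 'cV[R[i]]_p) : R := sqn (mRe v) + sqn (mIm v).

Lemma csqnE p (v : 'cV[R[i]]_p) : csqn v = \sum_i (Re (v i 0) ^+ 2 + Im (v i 0) ^+ 2).
Proof. by rewrite big_split /csqn !sqnE; congr (_ + _); apply: eq_bigr => i _; rewrite mxE. Qed.

Lemma csqn_ge0 p (v : 'cV[R[i]]_p) : 0 <= csqn v.
Proof. by rewrite addr_ge0 // sqn_ge0. Qed.

Lemma csqn_gt0 p (v : 'cV[R[i]]_p) : (0 < csqn v) = (v != 0).
Proof.
rewrite lt_neqAle csqn_ge0 andbT eq_sym; congr (~~ _).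
rewrite paddr_eq0 ?sqn_ge0 // !sqn_eq0; apply/andP/eqP => [[/eqP h1 /eqP h2]|->].
  exact: mReIm_eq0.
by rewrite !raddf0 !eqxx.
Qed.

Lemma csqn_scale p (c : R) (v : 'cV[R[i]]_p) :
  csqn (real_complex R c *: v) = c ^+ 2 * csqn v.
Proof.
rewrite /csqn mRe_scale mIm_scale /= !scale0r subr0 addr0.
by rewrite !bilfZl !bilfZr; ring.
Qed.

Lemma cnormE p (v : 'cV[R[i]]_p) : cnorm v = Num.sqrt (csqn v).
Proof. by rewrite csqnE. Qed.

Lemma sqn_col p q (x : 'cV[R]_p) (y : 'cV[R]_q) : sqn (col_mx x y) = sqn x + sqn y.
Proof.
rewrite !sqnE big_split_ord; congr (_ + _); apply: eq_bigr => i _.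
  by rewrite col_mxEu.
by rewrite col_mxEd.
Qed.

Lemma sqnN p (x : 'cV[R]_p) : sqn (- x) = sqn x.
Proof. by rewrite -scaleN1r bilfZl bilfZr; ring. Qed.

Lemma bilf1_mull p q (M : 'M[R]_(p, q)) x y : bilf 1%:M (M *m x) y = bilf M^T x y.
Proof. by rewrite /bilf trmx_mul mulmx1. Qed.

Lemma bilf1_mulr p q (M : 'M[R]_(p, q)) x y : bilf 1%:M x (M *m y) = bilf M x y.
Proof. by rewrite /bilf mulmx1 mulmxA. Qed.

(** The real matrix acting on stacked real and imaginary parts; it reduces gain duality to real
    matrices. *)
Definition realify p q (T : 'M[R[i]]_(p, q)) : 'M[R]_(p + p, q + q) :=
  block_mx (mRe T) (- mIm T) (mIm T) (mRe T).

Lemma csqn_mul p q (T : 'M[R[i]]_(p, q)) v :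
  csqn (T *m v) = sqn (realify T *m col_mx (mRe v) (mIm v)).
Proof.
rewrite /realify mul_block_col sqn_col /csqn mRe_mul mIm_mul mulNmx.
by congr (_ + sqn _); rewrite addrC.
Qed.

(** [(realify T)^T] represents the conjugate transpose while y T involves the plain one; conjugating
    y, whence the minus sign, reconciles them without changing norms. *)
Lemma csqn_mul_tr p q (T : 'M[R[i]]_(p, q)) (y : 'rV[R[i]]_p) :
  csqn (y *m T)^T = sqn ((realify T)^T *m col_mx (mRe y)^T (- (mIm y)^T)).
Proof.
rewrite /realify tr_block_mx mul_block_col sqn_col /csqn -!map_trmx mRe_mul mIm_mul.
rewrite !mulmxN [(- mIm T)^T]linearN /= mulNmx [(_ - _)^T]linearB [(_ + _)^T]linearD /= !trmx_mul.
by congr (_ + _); rewrite -opprD sqnN addrC.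
Qed.

(** With w = M^T z, expand |M w - k z|^2 >= 0 and insert |M w|^2 < k |w|^2. *)
Lemma gain_tr_lt p q (M : 'M[R]_(p, q)) k : 0 < k ->
  (forall w, w != 0 -> sqn (M *m w) < k * sqn w) ->
  forall z, z != 0 -> sqn (M^T *m z) < k * sqn z.
Proof.
move=> k0 h z z0; have z1 : 0 < sqn z by rewrite sqn_gt0.
have [->|w0] := eqVneq (M^T *m z) 0; first by rewrite bilf0l mulr_gt0.
have := sqn_ge0 (M *m (M^T *m z) + (- k) *: z); have := h _ w0.
rewrite !(bilfDl, bilfDr, bilfZl, bilfZr) (bilf_sym z _ (symmetric1 _)).
have -> : bilf 1%:M (M *m (M^T *m z)) z = sqn (M^T *m z).
  by rewrite bilf1_mull [RHS]bilf1_mulr.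
move: (sqn _) (sqn (M^T *m z)) (sqn z) z1 => s1 s2 s3 s30; nra.
Qed.

Lemma gain_tr_le p q (M : 'M[R]_(p, q)) k : 0 < k ->
  (forall z, sqn (M^T *m z) <= k * sqn z) ->
  forall w, sqn (M *m w) <= k * sqn w.
Proof.
move=> k0 h w.
have := sqn_ge0 (M^T *m (M *m w) + (- k) *: w); have := h (M *m w).
rewrite !(bilfDl, bilfDr, bilfZl, bilfZr) (bilf_sym w _ (symmetric1 _)).
have -> : bilf 1%:M (M^T *m (M *m w)) w = sqn (M *m w).
  by rewrite bilf1_mull trmxK [RHS]bilf1_mulr.
move: (sqn _) (sqn (M *m w)) (sqn w) => s1 s2 s3 h1 h2.
have : 0 <= k * (k * s3 - s2) by nra.
by rewrite pmulr_rge0 // subr_ge0.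
Qed.

Lemma csqn_gain_tr_lt p q (T : 'M[R[i]]_(p, q)) k : 0 < k ->
  (forall v, v != 0 -> csqn (T *m v) < k * csqn v) ->
  forall y : 'rV_p, y != 0 -> csqn (y *m T)^T < k * csqn y^T.
Proof.
move=> k0 h y y0; rewrite csqn_mul_tr.
have -> : csqn y^T = sqn (col_mx (mRe y)^T (- (mIm y)^T)).
  by rewrite sqn_col /csqn -!map_trmx sqnN.
apply: gain_tr_lt => // [w w0|].
  pose v : 'cV[R[i]]_q := \col_i Complex (usubmx w i 0) (dsubmx w i 0).
  have Ew : w = col_mx (mRe v) (mIm v).
    by rewrite -[LHS]vsubmxK; congr col_mx; apply/colP => i; rewrite !mxE.
  rewrite Ew -csqn_mul sqn_col; apply: h; apply: contra_neq w0 => v0.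
  by rewrite Ew v0 !raddf0 /= col_mx0.
rewrite -sqn_gt0 sqn_col sqnN !map_trmx.
by rewrite -/(csqn y^T) csqn_gt0; apply: contra_neq y0 => /(congr1 trmx); rewrite trmxK trmx0.
Qed.

Lemma csqn_gain_tr_le p q (T : 'M[R[i]]_(p, q)) k : 0 < k ->
  (forall y : 'rV_p, csqn (y *m T)^T <= k * csqn y^T) ->
  forall v, csqn (T *m v) <= k * csqn v.
Proof.
move=> k0 h v; rewrite csqn_mul -[csqn v]sqn_col; apply: gain_tr_le => // z.
pose y : 'rV[R[i]]_p := \row_i Complex (usubmx z i 0) (- dsubmx z i 0).
have Ez : z = col_mx (mRe y)^T (- (mIm y)^T).
  by rewrite -[LHS]vsubmxK; congr col_mx; apply/colP => i; rewrite !mxE ?opprK.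
rewrite Ez -csqn_mul_tr sqn_col sqnN !map_trmx.
exact: h.
Qed.

(** [Tinf] is the instance with state matrix [AK A B K] and output matrix [col_mx Qih (Rih *m K)].
    Gains are measured on row vectors y below, since y C (z - A)^-1 pairs with X through A^T. *)
Definition transfer n q r (A : 'M[R]_n) (C : 'M[R]_(q, n)) (Bw : 'M[R]_(n, r)) (z : R[i]) :=
  cmx C *m invmx (z%:M - cmx A) *m cmx Bw.

Lemma Hurwitz_resolvent n (A : 'M[R]_n) (w : R) : Hurwitz A ->
  (Complex 0 w)%:M - cmx A \in unitmx.
Proof.
move=> /Hurwitz_unitP /(_ (Complex 0 w) (lexx _)).
by move=> U; rewrite -[_ - cmx A]opprB -scaleN1r unitmxZ ?unitrN1.
Qed.

Lemma transfer_input n q r (A : 'M[R]_n) (C : 'M[R]_(q, n)) (Bw : 'M[R]_(n, r)) w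
    (y : 'rV[R[i]]_q) : Hurwitz A ->
  exists u : 'rV[R[i]]_n, u *m ((Complex 0 w)%:M - cmx A) = y *m cmx C /\
    y *m transfer A C Bw (Complex 0 w) = u *m cmx Bw.
Proof.
move=> /(@Hurwitz_resolvent _ _ w) U; exists (y *m cmx C *m invmx ((Complex 0 w)%:M - cmx A)).
by rewrite mulmxKV // /transfer !mulmxA.
Qed.

Lemma qform_gram p q (C : 'M[R]_(q, p)) x : qform (C^T *m C) x = sqn (C *m x).
Proof. by rewrite sqnT_mul. Qed.

Lemma qform_riccati n q r (A X : 'M[R]_n) (C : 'M[R]_(q, n)) (Bw : 'M[R]_(n, r)) c k x :
  Defs.symmetric X ->
  qform (lyap A X + c *: (X *m (C^T *m C) *m X) + k *: (Bw *m Bw^T)) x =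
  2 * bilf X x (A^T *m x) + c * sqn (C *m (X *m x)) + k * sqn (Bw^T *m x).
Proof.
move=> sX; rewrite bilfDm bilfDm !bilfZm qform_lyap // -[X in X *m _ *m _]sX bilf_mul.
by rewrite trmxK qform_gram -{1}[Bw]trmxK qform_gram.
Qed.

(* [c |CXu - p/c|^2 >= 0] for the two real components of u = y C (i w - A)^-1 *)
Lemma riccati_gain n q r (A X : 'M[R]_n) (C : 'M[R]_(q, n)) (Bw : 'M[R]_(n, r)) c k :
  Hurwitz A -> Defs.symmetric X -> 0 < c ->
  negsemidef (lyap A X + c *: (X *m (C^T *m C) *m X) + k *: (Bw *m Bw^T)) ->
  forall w (y : 'rV[R[i]]_q),
    c * k * csqn (y *m transfer A C Bw (Complex 0 w))^T <= csqn y^T.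
Proof.
move=> hA sX c0 hneg w y.
have [u [uG ->]] := transfer_input C Bw w y hA.
pose a := (mRe u)^T; pose b := (mIm u)^T; pose p := (mRe y)^T; pose s := (mIm y)^T.
have ha : A^T *m a = - w *: b - C^T *m p.
  have := congr1 (fun M => (mRe M)^T) uG.
  rewrite mulmxBr mul_mx_scalar map_mxB !mRe_mulc mRe_scale /= scale0r sub0r.
  rewrite linearB linearN linearZ /= !trmx_mul -/a -/b -/p => <-.
  by rewrite scaleNr opprB addrCA subrr addr0.
have hb : A^T *m b = w *: a - C^T *m s.
  have := congr1 (fun M => (mIm M)^T) uG.
  rewrite mulmxBr mul_mx_scalar map_mxB !mIm_mulc mIm_scale /= scale0r add0r.
  rewrite linearB linearZ /= !trmx_mul -/a -/b -/s => <-.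
  by rewrite opprB addrCA subrr addr0.
have := nsd_le0 a hneg; have := nsd_le0 b hneg.
rewrite !qform_riccati // ha hb !bilfDr !bilfZr.
have e x z : bilf X x (- (C^T *m z)) = - bilf 1%:M (C *m (X *m x)) z.
  rewrite -scaleN1r bilfZr mulN1r; congr (- _).
  by rewrite -bilf_mulr -[X in X *m _]sX -[X^T *m _]mulmx1 -trmx_mul bilf_mull trmxK mulmxA.
rewrite !e (bilf_sym b a sX).
have f z x : 0 <= c * sqn z - 2 * bilf 1%:M z x + sqn x / c.
  have := sqn_ge0 (c *: z - x); rewrite -scaleN1r !(bilfDl, bilfDr, bilfZl, bilfZr).
  rewrite (bilf_sym x z (symmetric1 _)) => h.
  have -> : c * sqn z - 2 * bilf 1%:M z x + sqn x / c =
    (c * (c * sqn z) + -1 * bilf 1%:M z x * c + (c * (-1 * bilf 1%:M z x) + -1 * (-1 * sqn x))) / c.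
    by field; rewrite gt_eqF.
  rewrite divr_ge0 ?(ltW c0) //; move: h; congr (_ <= _); ring.
have := f _ (C *m (X *m a)) p; have := f _ (C *m (X *m b)) s.
rewrite /csqn -!map_trmx mRe_mulc mIm_mulc !trmx_mul -/a -/b -/p -/s.
move=> f1 f2 g1 g2.
have : k * (sqn (Bw^T *m a) + sqn (Bw^T *m b)) <= (sqn p + sqn s) / c by lra.
by rewrite ler_pdivlMr // mulrC mulrA.
Qed.

(** A left eigenvector u at i w yields y = c u X C^T with y T(i w) = u Bw. The Riccati equation at u
    then reads |y|^2 = c k |u Bw|^2 <= c |y T(i w)|^2, against the gain condition. *)
Lemma riccati_no_imaginary_eigenvalue n q r (A X : 'M[R]_n) (C : 'M[R]_(q, n))
    (Bw : 'M[R]_(n, r)) c k w :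
  Hurwitz A -> Defs.symmetric X -> 0 < c -> 0 <= k <= 1 ->
  lyap A X + c *: (X *m (C^T *m C) *m X) + k *: (Bw *m Bw^T) = 0 ->
  (forall y : 'rV[R[i]]_q, y != 0 ->
    c * csqn (y *m transfer A C Bw (Complex 0 w))^T < csqn y^T) ->
  ~~ eigenvalue (cmx (A + c *: (X *m (C^T *m C)))) (Complex 0 w).
Proof.
move=> hA sX c0 /andP[k0 k1] hric hgain; apply/negP => /eigenvalueP[u uF u0].
pose y : 'rV[R[i]]_q := u *m cmx (c *: (X *m C^T)).
have uG : u *m ((Complex 0 w)%:M - cmx A) = y *m cmx C.
  rewrite mulmxBr mul_mx_scalar -uF /y -mulmxA -cmxM -mulmxBr !cmxE -map_mxB.
  by rewrite addrAC subrr add0r -scalemxAl mulmxA.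
have U := Hurwitz_resolvent w hA.
have yT : y *m transfer A C Bw (Complex 0 w) = u *m cmx Bw.
  by rewrite /transfer !mulmxA -uG mulmxK.
have y0 : y != 0.
  apply: contra_neq u0 => y0.
  by rewrite -(mulmxK U u) uG y0 !mul0mx.
have := hgain y y0; rewrite yT.
pose a := (mRe u)^T; pose b := (mIm u)^T.
have ey : csqn y^T = c ^+ 2 * (sqn (C *m (X *m a)) + sqn (C *m (X *m b))).
  rewrite /csqn -!map_trmx mRe_mulc mIm_mulc -scalemxAr !trmx_mul !linearZ /= !trmx_mul !trmxK sX.
  by rewrite -!scalemxAl !(bilfZl, bilfZr) -/a -/b -!mulmxA; ring.
have eT : csqn (u *m cmx Bw)^T = sqn (Bw^T *m a) + sqn (Bw^T *m b).
  by rewrite /csqn -!map_trmx mRe_mulc mIm_mulc !trmx_mul.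
rewrite ey eT.
have ha : A^T *m a = - w *: b - c *: (C^T *m (C *m (X *m a))).
  have := congr1 (fun M => (mRe M)^T) uF; rewrite mRe_mulc mRe_scale /= scale0r sub0r.
  rewrite trmx_mul linearD linearZ linearN linearZ /= !trmx_mul !trmxK sX mulmxDl -scalemxAl.
  by rewrite scaleNr -/a -/b => <-; rewrite -!mulmxA addrK.
have hb : A^T *m b = w *: a - c *: (C^T *m (C *m (X *m b))).
  have := congr1 (fun M => (mIm M)^T) uF; rewrite mIm_mulc mIm_scale /= scale0r add0r.
  rewrite trmx_mul linearD linearZ linearZ /= !trmx_mul !trmxK sX mulmxDl -scalemxAl.
  by rewrite -/a -/b => <-; rewrite -!mulmxA addrK.
have e x : bilf X x (- (c *: (C^T *m (C *m (X *m x))))) = - (c * sqn (C *m (X *m x))).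
  rewrite -scaleN1r !bilfZr mulN1r; congr (- (_ * _)).
  by rewrite -bilf_mulr -[X in X *m _]sX -[X^T *m _]mulmx1 -trmx_mul bilf_mull trmxK mulmxA.
have := qform_riccati A C Bw c k a sX; have := qform_riccati A C Bw c k b sX.
rewrite hric !bilf0m ha hb !bilfDr !bilfZr !e (bilf_sym b a sX).
have := sqn_ge0 (Bw^T *m a); have := sqn_ge0 (Bw^T *m b).
move: (sqn (Bw^T *m a)) (sqn (Bw^T *m b)) (sqn (C *m (X *m a))) (sqn (C *m (X *m b))) => s1 s2 s3 s4 g1 g2 g3 g4 g5.
have h1 : c * (s3 + s4) = k * (s1 + s2) by lra.
have h2 : k * (s1 + s2) <= s1 + s2 by rewrite ler_piMl // addr_ge0.
move: g5; rewrite expr2 -mulrA h1 ltr_pM2l // ltNge; lra.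
Qed.

End BoundedReal.

(** Completeness of matrix spaces, for the fixed point argument in [riccati_step]. *)
HB.instance Definition _ (R : realType) m n :=
  CompletePseudoMetric.on 'M[R]_(m, n).

(** * Limits of matrix expressions along a filter *)

Section MatrixLimits.
Context {R : realType} {T : Type} {F : set_system T} {FF : Filter F}.

Lemma cvg_mx p q (f : T -> 'M[R]_(p, q)) (a : 'M[R]_(p, q)) :
  (forall i j, f t i j @[t --> F] --> a i j) -> f t @[t --> F] --> a.
Proof.
move=> h; apply/cvg_ballP => e e0.
have : \forall t \near F, forall i j, ball (a i j) e (f t i j).
  apply: filter_forall => i; apply: filter_forall => j.
  by have /cvg_ballP/(_ e e0) := h i j.
by apply: filterS => t ht; split.
Qed.

Lemma cvg_mx_entry p q (f : T -> 'M[R]_(p, q)) (a : 'M[R]_(p, q)) i j :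
  f t @[t --> F] --> a -> f t i j @[t --> F] --> a i j.
Proof. move=> h.
exact: (cvg_comp f (fun M : 'M[R]_(p, q) => M i j) h (@coord_continuous _ _ _ i j a)). Qed.

Lemma cvg_mulmx p q r (f : T -> 'M[R]_(p, q)) (g : T -> 'M[R]_(q, r))
    (a : 'M[R]_(p, q)) (b : 'M[R]_(q, r)) :
  f t @[t --> F] --> a -> g t @[t --> F] --> b -> f t *m g t @[t --> F] --> a *m b.
Proof.
move=> hf hg; apply: cvg_mx => i j; under eq_cvg do rewrite mxE; rewrite mxE.
apply: (@cvg_big _ _ _ _ _ _ T F _ (fun k t => f t i k * g t k j)) => [|k _].
  exact: add_continuous.
by apply: cvgM; exact: cvg_mx_entry.
Qed.

Lemma cvg_trmx p q (f : T -> 'M[R]_(p, q)) (a : 'M[R]_(p, q)) :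
  f t @[t --> F] --> a -> (f t)^T @[t --> F] --> a^T.
Proof.
move=> hf; apply: cvg_mx => i j; under eq_cvg do rewrite mxE; rewrite mxE.
exact: cvg_mx_entry.
Qed.

Lemma cvg_addmx p q (f g : T -> 'M[R]_(p, q)) (a b : 'M[R]_(p, q)) :
  f t @[t --> F] --> a -> g t @[t --> F] --> b -> f t + g t @[t --> F] --> a + b.
Proof. by move=> hf hg; exact: cvgD. Qed.

Lemma cvg_scalemx p q (c : T -> R) (f : T -> 'M[R]_(p, q)) (k : R) (a : 'M[R]_(p, q)) :
  c t @[t --> F] --> k -> f t @[t --> F] --> a -> c t *: f t @[t --> F] --> k *: a.
Proof.
move=> hc hf; apply: cvg_mx => i j; under eq_cvg do rewrite mxE; rewrite mxE.
by apply: cvgM => //; exact: cvg_mx_entry.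
Qed.

Lemma cvg_mxtrace p (f : T -> 'M[R]_p) (a : 'M[R]_p) :
  f t @[t --> F] --> a -> \tr (f t) @[t --> F] --> \tr a.
Proof.
move=> hf; apply: (@cvg_big _ _ _ _ _ _ T F _ (fun k t => f t k k)) => [|k _].
  exact: add_continuous.
exact: cvg_mx_entry.
Qed.

Lemma cvg_bilf p q (f : T -> 'M[R]_(p, q)) (a : 'M[R]_(p, q)) x y :
  f t @[t --> F] --> a -> bilf (f t) x y @[t --> F] --> bilf a x y.
Proof.
move=> hf; rewrite /bilf; apply: cvg_mx_entry.
by apply: cvg_mulmx; [apply: cvg_mulmx => //|]; exact: cvg_cst.
Qed.

Lemma cvg_det p (f : T -> 'M[R]_p) (a : 'M[R]_p) :
  f t @[t --> F] --> a -> \det (f t) @[t --> F] --> \det a.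
Proof.
move=> hf; rewrite /determinant.
apply: (@cvg_big _ _ _ _ _ _ T F _ (fun (s : 'S_p) t => (-1) ^+ s * \prod_i f t i (s i))) => [|s _].
  exact: add_continuous.
apply: cvgM; first exact: cvg_cst.
apply: (@cvg_big _ _ _ _ _ _ T F _ (fun i t => f t i (s i))) => [|k _].
  exact: mul_continuous.
exact: cvg_mx_entry.
Qed.

Lemma cvg_invmx p (f : T -> 'M[R]_p) (a : 'M[R]_p) : a \in unitmx ->
  f t @[t --> F] --> a -> invmx (f t) @[t --> F] --> invmx a.
Proof.
move=> ua hf.
have d0 : \det a != 0 by rewrite -unitfE -unitmxE.
have hd := cvg_det hf.
have near_unit : \forall t \near F, f t \in unitmx.
  have h : F [set t | \det (f t) != 0] := hd _ (open_nbhs_nbhs (conj (@open_neq R 0) d0)).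
  by apply: filterS h => t /=; rewrite unitmxE unitfE.
have E b : b \in unitmx -> invmx b = (\det b)^-1 *: \adj b by rewrite /invmx => ->.
rewrite E //; apply: (cvg_trans (G := (\det (f t))^-1 *: \adj (f t) @[t --> F])).
  by apply: near_eq_cvg; apply: filterS near_unit => t ut; rewrite E.
apply: cvg_scalemx; first exact: cvgV.
apply: cvg_mx => i j; under eq_cvg do rewrite mxE; rewrite mxE.
rewrite /cofactor; apply: cvgM; first exact: cvg_cst.
apply: cvg_det; apply: cvg_mx => k l; under eq_cvg do rewrite !mxE; rewrite !mxE.
exact: cvg_mx_entry.
Qed.

End MatrixLimits.

(** * Closed sets and their projections along locally bounded fibres *)

Section ClosedProjection.
Context {R : realType}.

Lemma closed_fge0 (T : topologicalType) (f : T -> R) : continuous f ->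
  closed [set x | 0 <= f x].
Proof.
by move=> cf; apply: (@preimage_closed _ _ f [set y : R | 0 <= y]) => [x _|]; [exact: cf|exact: closed_ge].
Qed.

Lemma closed_feq0 (T : topologicalType) (f : T -> R) : continuous f ->
  closed [set x | f x = 0].
Proof.
by move=> cf; apply: (@preimage_closed _ _ f [set y : R | y = 0]) => [x _|]; [exact: cf|exact: closed_eq].
Qed.

Lemma closed_mx_eq0 (T : topologicalType) p q (f : T -> 'M[R]_(p, q)) : continuous f ->
  closed [set x | f x = 0].
Proof.
move=> cf; rewrite (_ : mkset _ = \bigcap_(ij in setT) [set x | f x ij.1 ij.2 = 0]).
  by apply: closed_bigI => -[i j] _; apply: closed_feq0 => x; apply: cvg_mx_entry; exact: cf.
apply/seteqP; split=> x /= h; first by move=> [i j] _ /=; rewrite h mxE.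
by apply/matrixP => i j; rewrite mxE; exact: (h (i, j)).
Qed.

Lemma mx_box_compact p q (r : R) :
  compact [set X : 'M[R]_(p, q) | forall i j, `|X i j| <= r].
Proof.
have -> : [set X : 'M[R]_(p, q) | forall i j, `|X i j| <= r] =
   vec_mx @` [set v : 'rV[R]_(p * q) | forall i, `[- r, r]%classic (v 0 i)].
  apply/seteqP; split=> [X hX|_ [v hv <-] i j].
    exists (mxvec X); last exact: mxvecK.
    by move=> k /=; case/mxvec_indexP: k => i j; rewrite mxvecE in_itv /= -ler_norml.
  by rewrite mxE; have := hv (mxvec_index i j); rewrite /= in_itv /= -ler_norml.
apply: continuous_compact.
  apply: continuous_subspaceT => v; apply: (cvg_mx (FF := nbhs_filter v)) => i j.
  by under eq_cvg do rewrite mxE; rewrite mxE; exact: coord_continuous.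
apply: (@rV_compact _ _ (fun=> `[- r, r]%classic)) => _; exact: segment_compact.
Qed.

(** Tube lemma: near t0 the fibres lie in one compact box. If the fibre over t0 is empty,
    compactness of the box empties the fibres over a whole neighbourhood. *)
Lemma closed_proj_bounded (T : topologicalType) p q (C : T -> 'M[R]_(p, q) -> Prop) :
  closed [set x : T * 'M[R]_(p, q) | C x.1 x.2] ->
  (forall t0 : T, exists r : R, \forall t \near t0, forall X, C t X -> forall i j, `|X i j| <= r) ->
  closed [set t | exists X, C t X].
Proof.
move=> clC hb; rewrite closedE => t0 /= hn; apply: contrapT => nC; apply: hn.
have [r hr] := hb t0.
have := (compact_near_coveringP _).1 (mx_box_compact (p := p) (q := q) (r := r)).
move=> /(_ T (nbhs t0) (fun t X => ~ C t X) _) hK.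
have : \forall t \near t0, [set X : 'M[R]_(p, q) | forall i j, `|X i j| <= r] `<=` (fun X => ~ C t X).
  apply: hK => X _; have := closed_openC clC; rewrite openE => /(_ (t0, X)) h.
  have : (~` [set x : T * 'M[R]_(p, q) | C x.1 x.2]) (t0, X) by move=> /= c; apply: nC; exists X.
  move=> /h [[U V] /= [Ut VX] UV]; exists (V, U) => //= -[X' t] /= [VX' Ut'].
  exact: (UV (t, X')).
apply: filterS2 hr => t hC hD [X CX].
by apply: (hD X _ CX); exact: hC CX.
Qed.

End ClosedProjection.

(** * Small solutions of the Riccati equation with a small constant term *)

Section RiccatiStep.
Context {R : realType}.

(* Banach contraction for D = L (- c D S D - d W), L the inverse of the Lyapunov operator of H. *)
Lemma riccati_step n (H S W : 'M[R]_n) c : Hurwitz H -> 0 <= c -> Defs.symmetric S ->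
  Defs.symmetric W ->
  exists2 d0, 0 < d0 & forall d, 0 <= d <= d0 -> exists D,
    [/\ Defs.symmetric D, lyap H D + c *: (D *m S *m D) + d *: W = 0 &
        Hurwitz (H + c *: (D *m S))].
Proof.
move=> hH c0 sS sW.
have [e e0 he] := Hurwitz_open hH.
have [L [l l0 hL]] := lyap_solve hH.
have LB M N : L M - L N = L (M - N).
  apply/eqP; rewrite -subr_eq0; apply/eqP; apply: (lyap_inj hH).
  by rewrite !lyapD !lyapN (hL M).1 (hL N).1 (hL (M - N)).1 subrr.
have Lsym M : Defs.symmetric M -> Defs.symmetric (L M).
  move=> sM; apply/eqP; rewrite -subr_eq0; apply/eqP; apply: (lyap_inj hH).
  by rewrite lyapD lyapN -lyap_tr (hL M).1 sM subrr.
pose s := 1 + c * n%:R ^+ 2 * `|S|.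
have s0 : 0 < s by rewrite ltr_wpDr // !mulr_ge0 ?exprn_ge0.
have hs (D E : 'M[R]_n) : `|c *: (D *m S *m E)| <= s * (`|D| * `|E|).
  rewrite normrZ ger0_norm //.
  apply: (le_trans (y := c * (n%:R * ((n%:R * (`|D| * `|S|)) * `|E|)))).
    rewrite ler_wpM2l //; apply: le_trans (mx_norm_mul _ _) _.
    by rewrite ler_wpM2l // ler_wpM2r // mx_norm_mul.
  have -> : c * (n%:R * (n%:R * (`|D| * `|S|) * `|E|)) = c * n%:R ^+ 2 * `|S| * (`|D| * `|E|) by ring.
  by rewrite ler_wpM2r ?mulr_ge0 // /s lerDr.
(* The first bound gives l s r <= 1/4, hence a contraction factor 1/2 on the ball of radius r; the
   second keeps c D S within the radius e of [Hurwitz_open]. *)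
pose r := Num.min (1 / (4 * l * s)) (e / (1 + c * n%:R * `|S|)).
have q0 : 0 < 1 + c * n%:R * `|S| by rewrite ltr_wpDr // !mulr_ge0.
have r0 : 0 < r by rewrite lt_min !divr_gt0 ?mulr_gt0.
have r1 : l * s * r <= 1 / 4.
  have : r <= 1 / (4 * l * s) by rewrite ge_min lexx.
  rewrite ler_pdivlMr ?mulr_gt0 // => h; nra.
have w0 : 0 < 1 + `|W| by rewrite ltr_wpDr.
(* For such d the constant term contributes at most r/2 to the norm, leaving room for the quadratic
   term, at most r/4. *)
exists (r / (2 * l * (1 + `|W|))); first by rewrite divr_gt0 ?mulr_gt0.
move=> d /andP[d0 dd].
(* Symmetry is part of the invariant set, so the fixed point inherits it. *)
pose U := [set D : 'M[R]_n | `|D| <= r /\ D^T = D].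
pose f := fun D : 'M[R]_n => L (- (c *: (D *m S *m D) + d *: W)).
have fU D : U D -> U (f D).
  move=> [Dr sD]; split; last first.
    apply: Lsym; apply: symmetricN; apply: symmetricD; apply: symmetricZ => //.
    by rewrite /Defs.symmetric !trmx_mul sD sS mulmxA.
  apply: le_trans (hL _).2 _; rewrite normrN.
  have h1 : `|c *: (D *m S *m D)| <= s * (r * r).
    by apply: le_trans (hs _ _) _; rewrite ler_wpM2l ?(ltW s0) // ler_pM.
  have h2 : l * `|d *: W| <= r / 2.
    rewrite normrZ ger0_norm //; apply: (le_trans (y := l * (d * (1 + `|W|)))).
      by rewrite ler_wpM2l ?(ltW l0) // ler_wpM2l // lerDr.
    move: dd; rewrite ler_pdivlMr ?mulr_gt0 // => dd; lra.
  apply: (le_trans (y := l * (`|c *: (D *m S *m D)| + `|d *: W|))).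
    by rewrite ler_wpM2l ?(ltW l0) // ler_normD.
  have h3 : l * `|c *: (D *m S *m D)| <= l * (s * (r * r)) by rewrite ler_wpM2l // ltW.
  have h4 : l * (s * (r * r)) <= 1 / 4 * r by rewrite !mulrA ler_wpM2r // ltW.
  rewrite mulrDr; lra.
have hfun : set_fun U U f by move=> D; exact: fU.
pose F : {fun U >-> U} := HB.pack_for {fun U >-> U} f (isFun.Build _ _ U U f hfun).
have cU : closed U.
  rewrite (_ : U = [set D : 'M[R]_n | 0 <= r - `|D|] `&` [set D | D^T - D = 0]); last first.
    apply/seteqP; split=> D /= [h1 h2]; split; [by rewrite subr_ge0|by rewrite h2 subrr|by rewrite -subr_ge0|].
    by apply/eqP; rewrite -subr_eq0 h2.
  apply: closedI.
    apply: closed_fge0 => D.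
    exact: (cvgB (cvg_cst r) (@norm_continuous _ _ D)).
  apply: closed_mx_eq0 => D.
  exact: (cvgB (cvg_trmx (FF := nbhs_filter D) cvg_id) cvg_id).
have hF : is_contraction F.
  exists (2^-1)%:nng; split; first by rewrite /=; lra.
  move=> [D E] /= [[Dr sD] [Er sE]].
  rewrite /f LB; apply: le_trans (hL _).2 _.
  have -> : - (c *: (D *m S *m D) + d *: W) - - (c *: (E *m S *m E) + d *: W) =
    - (c *: (D *m S *m (D - E)) + c *: ((D - E) *m S *m E)).
    rewrite -scalerDr mulmxBr !mulmxBl addrA subrK -opprD -opprB opprK scalerBr.
    by rewrite opprB opprD addrACA subrr addr0.
  rewrite normrN.
  have h1 : `|c *: (D *m S *m (D - E))| <= s * (r * `|D - E|).
    by apply: le_trans (hs _ _) _; rewrite ler_wpM2l ?(ltW s0) // ler_wpM2r.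
  have h2 : `|c *: ((D - E) *m S *m E)| <= s * (r * `|D - E|).
    by apply: le_trans (hs _ _) _; rewrite ler_wpM2l ?(ltW s0) // mulrC ler_wpM2r.
  apply: (le_trans (y := l * (2 * (s * (r * `|D - E|))))).
    by rewrite ler_wpM2l ?(ltW l0) //; apply: le_trans (ler_normD _ _) _; lra.
  have := ler_wpM2r (normr_ge0 (D - E)) r1; lra.
have [D [Dr sD] fD] := banach_fixed_point hF cU (ex_intro _ 0 (conj (ltW (eq_ind_r (fun x => x < r) r0 (normr0 _))) (trmx0 _ _ _))).
exists D; split; [exact: sD| |].
  have := (hL (- (c *: (D *m S *m D) + d *: W))).1.
  by rewrite -[L _]fD => ->; rewrite -addrA addNr.
apply: he; rewrite normrZ ger0_norm //.
apply: (le_trans (y := c * (n%:R * (r * `|S|)))).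
  by rewrite ler_wpM2l //; apply: le_trans (mx_norm_mul _ _) _; rewrite ler_wpM2l // ler_wpM2r.
have : r <= e / (1 + c * n%:R * `|S|) by rewrite ge_min lexx orbT.
rewrite ler_pdivlMr // => h.
by have := ltW r0; lra.
Qed.

End RiccatiStep.

(** * Existence of the stabilizing solution by continuation *)

Section RiccatiExistence.
Context {R : realType}.

Definition frob p q (M : 'M[R]_(p, q)) : R := \sum_i \sum_j M i j ^+ 2.

(** The estimate |x| <= 1 + x^2 spares a square root. *)
Lemma frob_entry p q (M : 'M[R]_(p, q)) i j : `|M i j| <= 1 + frob M.
Proof.
have h : M i j ^+ 2 <= frob M.
  rewrite /frob (bigD1 i) //= (bigD1 j) //= -addrA lerDl addr_ge0 ?sumr_ge0 // => [k _|k _].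
    exact: sqr_ge0.
  by apply: sumr_ge0 => l _; exact: sqr_ge0.
apply: le_trans (lerD (lexx 1) h); rewrite -real_normK ?num_real //.
have := sqr_ge0 (`|M i j| - 2^-1); lra.
Qed.

Lemma nsd_mxtrace p (M : 'M[R]_p) : negsemidef M -> \tr M <= 0.
Proof.
move=> hM; rewrite /mxtrace -oppr_ge0 -sumrN; apply: sumr_ge0 => k _.
rewrite oppr_ge0; have := nsd_le0 (delta_mx k 0) hM.
by rewrite /bilf trmx_delta -rowE -colE !mxE.
Qed.

Lemma psd_mxtrace p (M : 'M[R]_p) : possemidef M -> 0 <= \tr M.
Proof. by move=> hM; rewrite -[M]mul1mx psd_mxtrace_mul_ge0 //; exact/posdef_psd/posdef1. Qed.

(* Take the trace; [c q |X|^2 <= - 2 tr (A X) <= 2 |A|^2 / (c q) + (c q / 2) |X|^2]. *)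
Lemma riccati_frob_bound n (A S W X : 'M[R]_n) c q : 0 < c -> 0 < q ->
  (forall x, q * sqn x <= qform S x) -> Defs.symmetric X -> possemidef W ->
  negsemidef (lyap A X + c *: (X *m S *m X) + W) ->
  frob X <= 4 * frob A / (c * q) ^+ 2.
Proof.
move=> c0 q0 hS sX hW /nsd_mxtrace; rewrite mxtraceD mxtraceD mxtraceZ.
have cq : 0 < c * q by rewrite mulr_gt0.
have h1 : q * frob X <= \tr (X *m S *m X).
  rewrite /mxtrace mulr_sumr; apply: ler_sum => k _.
  have -> : (X *m S *m X) k k = qform S (X *m delta_mx k 0).
    have -> : (X *m S *m X) k k = ((delta_mx k 0 : 'cV[R]_n)^T *m (X *m S *m X) *m delta_mx k (0 : 'I_1)) 0 0.
      by rewrite trmx_delta -rowE -colE !mxE.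
    by rewrite -/(bilf _ _ _) bilf_mul sX.
  apply: le_trans (hS _); rewrite sqnE; apply: ler_wpM2l; first exact: ltW.
  by apply: ler_sum => j _; rewrite -colE mxE -{1}sX mxE.
have h2 : \tr (lyap A X) = 2 * \tr (A *m X).
  by rewrite /lyap linearD /= -[X in \tr (X *m A^T)]sX -trmx_mul mxtrace_tr; ring.
have h3 : - (2 * \tr (A *m X)) <= 2 / (c * q) * frob A + c * q / 2 * frob X.
  have -> : \tr (A *m X) = \sum_i \sum_j A i j * X i j.
    apply: eq_bigr => i _; rewrite mxE; apply: eq_bigr => j _.
    by rewrite -[in RHS]sX mxE.
  rewrite /frob !mulr_sumr -sumrN -big_split; apply: ler_sum => i _.
  rewrite !mulr_sumr -sumrN -big_split; apply: ler_sum => j _ /=.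
  have := sqr_ge0 (2 / (c * q) * A i j + X i j).
  rewrite -(pmulr_rge0 _ (divr_gt0 cq (ltr0Sn R 1))) => h; rewrite -subr_ge0.
  move: h; congr (_ <= _); field; rewrite !gt_eqF //.
have h4 := psd_mxtrace hW.
rewrite h2 => h5.
have h6 : c * (q * frob X) <= c * \tr (X *m S *m X) by rewrite ler_wpM2l // ltW.
rewrite ler_pdivlMr ?exprn_gt0 //.
have h7 : c * q / 2 * frob X <= 2 / (c * q) * frob A by lra.
have := ler_wpM2l (ltW (mulr_gt0 (ltr0Sn R 1) cq)) h7.
have -> : 2 * (c * q) * (2 / (c * q) * frob A) = 4 * frob A by field; rewrite !gt_eqF.
by move=> h; apply: le_trans h; rewrite le_eqVlt; apply/orP; left; apply/eqP; field.
Qed.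

(** Exact second-order expansion at X: the linear part is the Lyapunov operator of the closed loop A
    + c X S, the remainder is c D S D. Continuation, minimality and strict feasibility all rest on
    it. *)
Lemma riccati_shift n (A S X D : 'M[R]_n) c : Defs.symmetric X -> Defs.symmetric S ->
  Defs.symmetric D ->
  lyap A (X + D) + c *: ((X + D) *m S *m (X + D)) =
  lyap A X + c *: (X *m S *m X) + (lyap (A + c *: (X *m S)) D + c *: (D *m S *m D)).
Proof.
move=> sX sS sD; rewrite lyapD lyap_addl.
have -> : lyap (c *: (X *m S)) D = c *: (X *m S *m D) + c *: (D *m S *m X).
  by rewrite /lyap -scalemxAl linearZ /= trmx_mul sX sS -scalemxAr mulmxA.
rewrite !mulmxDl !mulmxDr !scalerDr.
have gen (V : zmodType) (a b e f g h : V) :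
    a + b + (h + g + (f + e)) = a + h + (b + (g + f) + e).
  by rewrite -!addrA; congr (_ + _); rewrite addrCA.
exact: gen.
Qed.

(** The supremum belongs to E by closedness, and a step beyond it is possible unless it is 1. *)
Lemma closed_sup_induction (E : set R) : closed E -> E 0 ->
  (forall t, E t -> 0 <= t <= 1) ->
  (forall t, E t -> exists2 d0, 0 < d0 & forall d, 0 <= d <= d0 -> t + d <= 1 -> E (t + d)) ->
  E 1.
Proof.
move=> cE E0 E01 Estep.
have bE : has_ubound E by exists 1 => t /E01 /andP[].
have Es : E (sup E) by apply: cE; apply: closure_sup => //; exists 0.
have /andP[s0 s1] := E01 _ Es.
have [d0 d00 hd] := Estep _ Es.
move: s1; rewrite le_eqVlt => /orP[/eqP <- //|s1].
pose d := Num.min d0 (1 - sup E).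
have d1 : 0 < d by rewrite lt_min d00 subr_gt0.
have : E (sup E + d).
  apply: hd; first by rewrite ltW //= ge_min lexx.
  by rewrite -lerBrDl ge_min lexx orbT.
by move=> /(ub_le_sup bE); rewrite gerDl leNgt d1.
Qed.

(* Continuation in the weight tau of Bw Bw^T from tau = 0 (X = 0) to tau = 1. *)
Lemma riccati_exists n q r (A : 'M[R]_n) (C : 'M[R]_(q, n)) (Bw : 'M[R]_(n, r)) c :
  Hurwitz A -> 0 < c -> posdef (C^T *m C) ->
  (forall w (y : 'rV[R[i]]_q), y != 0 ->
    c * csqn (y *m transfer A C Bw (Complex 0 w))^T < csqn y^T) ->
  exists X, [/\ Defs.symmetric X,
    lyap A X + c *: (X *m (C^T *m C) *m X) + Bw *m Bw^T = 0 &
    Hurwitz (A + c *: (X *m (C^T *m C)))].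
Proof.
move=> hA c0 hS hgain; set S := C^T *m C; set W := Bw *m Bw^T.
have [e e0 he] := posdef_lower_bound hS.
have sS : Defs.symmetric S by case: hS.
have sW : Defs.symmetric W by case: (psd_gram Bw).
(* Every clause is closed in (t, X). The last one stands in for the Hurwitz property of the closed
   loop, which is not a closed condition; [PH] recovers that property. *)
pose P (t : R) (X : 'M[R]_n) := [/\ 0 <= t, 0 <= 1 - t, X^T - X = 0,
  lyap A X + c *: (X *m S *m X) + t *: W = 0 &
  forall ab : R * R, 0 < ab.1 -> 0 <=
    `|shift_det (A + c *: (X *m S)) ab.1 ab.2| - ab.1 ^+ n * ab.1 ^+ n].
have PH t X : P t X -> Defs.symmetric X /\ Hurwitz (A + c *: (X *m S)).
  move=> [t0 t1 /eqP]; rewrite subr_eq0 => /eqP sX ric hdet; split; first exact: sX.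
  move=> z ez.
  (* The gain condition excludes Re z = 0, and the determinant bound excludes Re z > 0. *)
  rewrite lt_neqAle; apply/andP; split.
    apply: contraTneq ez => z0.
    have -> : z = Complex 0 (Im z) by case: z z0 => a b /= ->.
    apply: (riccati_no_imaginary_eigenvalue hA sX c0 _ ric (hgain _)).
    by rewrite t0 -subr_ge0.
  rewrite leNgt; apply/negP => z0.
  have := hdet (Re z, Im z) z0; rewrite /= (eigenvalue_shift_det ez) normr0 sub0r oppr_ge0.
  by rewrite leNgt mulr_gt0 // exprn_gt0.
pose E := [set t : R | exists X, P t X].
have E1 : E 1.
  apply: closed_sup_induction.
  - apply: closed_proj_bounded; last first.
      move=> t0; exists (1 + 4 * frob A / (c * e) ^+ 2); have FF := nbhs_filter t0.
      apply: filterE => t X PX i j.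
      have [sX _] := PH _ _ PX; case: PX => t1 t2 _ ric _.
      apply: le_trans (frob_entry _ _ _) _; rewrite lerD2l.
      apply: (riccati_frob_bound (W := t *: W) c0 e0 he sX).
        by apply: psdZ => //; exact: psd_gram.
      by rewrite ric; split=> [|x]; rewrite -/(bilf _ _ _) ?bilf0m // /Defs.symmetric trmx0.
    have cs (x : R * 'M[R]_n) : y.1 @[y --> x] --> x.1 by exact: cvg_fst.
    have cm (x : R * 'M[R]_n) : y.2 @[y --> x] --> x.2 by exact: cvg_snd.
    rewrite (_ : mkset _ = [set x : R * 'M[R]_n | 0 <= x.1] `&`
      ([set x : R * 'M[R]_n | 0 <= 1 - x.1] `&` ([set x : R * 'M[R]_n | x.2^T - x.2 = 0] `&`
      ([set x : R * 'M[R]_n | lyap A x.2 + c *: (x.2 *m S *m x.2) + x.1 *: W = 0] `&`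
       \bigcap_(ab in [set ab : R * R | 0 < ab.1]) [set x : R * 'M[R]_n | 0 <=
    `|shift_det (A + c *: (x.2 *m S)) ab.1 ab.2| - ab.1 ^+ n * ab.1 ^+ n])))); last first.
      by apply/seteqP; split=> x; [case|move=> [? [? [? []]]]].
    apply: closedI; [|apply: closedI; [|apply: closedI; [|apply: closedI]]].
    + by apply: closed_fge0 => x; exact: cs.
    + apply: closed_fge0 => x; exact: (cvgB (cvg_cst (1 : R)) (cs x)).
    + apply: closed_mx_eq0 => x; exact: (cvgB (cvg_trmx (FF := nbhs_filter x) (cm x)) (cm x)).
    + apply: closed_mx_eq0 => x; rewrite /lyap.
      apply: (@cvg_addmx R _ (nbhs x) _ n n); last first.
        by apply: cvg_scalemx; [exact: cs|exact: cvg_cst].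
      apply: (@cvg_addmx R _ (nbhs x) _ n n).
        by apply: (@cvg_addmx R _ (nbhs x) _ n n); apply: cvg_mulmx; (exact: cvg_cst || exact: cm).
      apply: (@cvg_scalemx R _ (nbhs x) _ n n (fun=> c)); first exact: cvg_cst.
      by apply: cvg_mulmx; [apply: cvg_mulmx; [exact: cm|exact: cvg_cst]|exact: cm].
    + apply: closed_bigI => -[a b] _ /=; apply: closed_fge0 => x.
      have cF : A + c *: (y.2 *m S) - a%:M @[y --> x] --> A + c *: (x.2 *m S) - a%:M.
        apply: (@cvg_addmx R _ (nbhs x) _ n n); last exact: cvg_cst.
        apply: (@cvg_addmx R _ (nbhs x) _ n n); first exact: cvg_cst.
        apply: (@cvg_scalemx R _ (nbhs x) _ n n (fun=> c)); first exact: cvg_cst.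
        by apply: cvg_mulmx; [exact: cm|exact: cvg_cst].
      have cd : shift_det (A + c *: (y.2 *m S)) a b @[y --> x] --> shift_det (A + c *: (x.2 *m S)) a b.
        apply: (@cvg_det R _ (nbhs x)); apply: (@cvg_addmx R _ (nbhs x) _ n n); last exact: cvg_cst.
        exact: cvg_mulmx.
      exact: (cvgB (cvg_norm cd) (cvg_cst (a ^+ n * a ^+ n))).
  - exists 0; split; rewrite ?lexx ?subr0 ?ler01 ?trmx0 ?subrr //.
      by rewrite /lyap !(mulmx0, mul0mx) scaler0 scale0r !addr0.
    move=> [a b] /= a0; rewrite mul0mx scaler0 addr0 subr_ge0.
    by apply: Hurwitz_shift_det => //; exact: ltW.
  - by move=> t [X [h0 h1 _ _ _]]; rewrite h0 -subr_ge0.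
  (* D solves the Riccati equation of the closed loop at X with weight d, so by [riccati_shift] X +
     D solves the original one with weight t + d. *)
  - move=> t [X PX]; have [sX hF] := PH _ _ PX.
    have [d0 d00 hd] := riccati_step hF (ltW c0) sS sW.
    exists d0 => // d dd td; have [D [sD ric hFD]] := hd d dd.
    have sXD := symmetricD sX sD.
    case: PX => t0 t1 _ ricX _.
    exists (X + D); split.
    + by rewrite addr_ge0 //; case/andP: dd.
    + by rewrite subr_ge0.
    + by rewrite sXD subrr.
    + rewrite (riccati_shift _ _ sX sS sD) scalerDl addrACA [X in X + _ = _]addrC.
      by rewrite -addrA ric addr0 addrC.
    + move=> [a b] /= a0; rewrite mulmxDl scalerDr addrA subr_ge0.
      by apply: Hurwitz_shift_det => //; exact: ltW.
have [X PX] := E1; have [sX hF] := PH _ _ PX.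
by exists X; split=> //; case: PX => _ _ _ + _; rewrite scale1r.
Qed.

End RiccatiExistence.

(** * The H-infinity norm as a bound on all frequency-wise gains *)

Section HinfNorm.
Context {R : realType} {n m : nat}.
Variables (A : 'M[R]_n) (B : 'M[R]_(n, m)) (Bw : 'M[R]_n).
Variables (Qih : 'M[R]_n) (Rih : 'M[R]_m) (K : 'M[R]_(m, n)).

Lemma hinf_norm_lt_gain b : 0 < b ->
  (hinf_norm A B Bw Qih Rih K < b%:E)%E -> forall w (v : 'cV[R[i]]_n), v != 0 ->
  csqn (transfer (AK A B K) (col_mx Qih (Rih *m K)) Bw (Complex 0 w) *m v) < b ^+ 2 * csqn v.
Proof.
move=> b0 hb w v; rewrite -csqn_gt0 => v0.
set T := transfer _ _ _ _.
pose c := (Num.sqrt (csqn v))^-1.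
have c2 : c ^+ 2 = (csqn v)^-1 by rewrite exprVn sqr_sqrtr // ltW.
have : ((cnorm (T *m (real_complex R c *: v)))%:E < b%:E)%E.
  apply: le_lt_trans hb; apply: (le_trans (y := sigma_max T)).
    apply: ereal_sup_ubound; exists (real_complex R c *: v) => //=.
    by rewrite cnormE csqn_scale c2 mulVf ?gt_eqF // sqrtr1.
  by apply: ereal_sup_ubound; exists w.
rewrite lte_fin cnormE -scalemxAr csqn_scale c2 => h.
have : ((csqn v)^-1 * csqn (T *m v)) < b ^+ 2.
  rewrite -[ltLHS]sqr_sqrtr; last by rewrite mulr_ge0 ?invr_ge0 ?csqn_ge0.
  by rewrite ltr_pXn2r // ?nnegrE ?sqrtr_ge0 // ltW.
by rewrite mulrC ltr_pdivrMr.
Qed.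

(** A uniform k < b^2 keeps the inequality strict through the suprema over w and v; a strict bound
    for each frequency separately would not. *)
Lemma gain_hinf_norm_lt b k : 0 < b -> k < b ^+ 2 ->
  (forall w (v : 'cV[R[i]]_n),
  csqn (transfer (AK A B K) (col_mx Qih (Rih *m K)) Bw (Complex 0 w) *m v) <= k * csqn v) ->
  (hinf_norm A B Bw Qih Rih K < b%:E)%E.
Proof.
move=> b0 kb h; apply: (@le_lt_trans _ _ (Num.sqrt k)%:E); last first.
  rewrite lte_fin; have -> : b = Num.sqrt (b ^+ 2) by rewrite sqrtr_sqr gtr0_norm.
  by rewrite ltr_sqrt // exprn_gt0.
apply: ge_ereal_sup => _ [w _ <-]; apply: ge_ereal_sup => _ [v /= v1 <-].
rewrite lee_fin cnormE; apply: ler_wsqrtr; apply: le_trans (h w v) _.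
have -> : csqn v = 1; last by rewrite mulr1.
by move: v1; rewrite cnormE => /(congr1 (fun x => x ^+ 2)); rewrite sqr_sqrtr ?csqn_ge0 // expr1n.
Qed.

End HinfNorm.

(** * The Riccati inequality for A_K, its minimal solution and the mixed cost *)

Section Mixed.
Context {R : realType} {n m : nat}.
Variables (A : 'M[R]_n) (B : 'M[R]_(n, m)) (Bw : 'M[R]_n).
Variables (Q2 : 'M[R]_n) (R2 : 'M[R]_m) (Qinf Qih : 'M[R]_n) (Rinf Rih : 'M[R]_m).
Variable beta : R.
Hypothesis hQih : possemidef Qih /\ Qih *m Qih = Qinf.
Hypothesis hRih : possemidef Rih /\ Rih *m Rih = Rinf.
Hypothesis hbeta : 0 < beta.
Hypothesis hQ2 : possemidef Q2.
Hypothesis hW : posdef (Bw *m Bw^T).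
Hypothesis hQinf : posdef Qinf.
Hypothesis hR2 : posdef R2.

Local Notation outC K := (col_mx Qih (Rih *m K)).
Local Notation ricK := (ric A B Bw Qinf Rinf beta).
Local Notation X_ := (XK A B Bw Qinf Rinf beta).
Local Notation cost K X := (\tr (Q2 *m X) + \tr (R2 *m K *m X *m K^T)).

Lemma SKE K : SK Qinf Rinf K = (outC K)^T *m outC K.
Proof.
rewrite tr_col_mx mul_row_col /SK -hQih.2 -hRih.2 trmx_mul.
by have [[-> _] _] := hQih; have [[-> _] _] := hRih; rewrite !mulmxA.
Qed.

Lemma SK_posdef K : posdef (SK Qinf Rinf K).
Proof.
rewrite /SK; apply: posdef_psdD => //; rewrite -{2}[K]trmxK; apply: psd_conj.
by rewrite -hRih.2; have [[e _] _] := hRih; rewrite -{2}e; exact: psd_gram.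
Qed.

Lemma SK_sym K : Defs.symmetric (SK Qinf Rinf K).
Proof. by case: (SK_posdef K). Qed.

Lemma ricE K X : ricK K X = lyap (AK A B K) X + beta ^- 2 *: (X *m SK Qinf Rinf K *m X)
  + Bw *m Bw^T.
Proof. by []. Qed.

Lemma beta2_gt0 : 0 < beta ^- 2.
Proof. by rewrite invr_gt0 exprn_gt0. Qed.

Lemma ric_sym K X : Defs.symmetric X -> Defs.symmetric (ricK K X).
Proof.
move=> sX; rewrite ricE; apply: symmetricD; last by case: hW.
apply: symmetricD; first exact: lyap_sym.
apply: symmetricZ; rewrite -[X in _ *m X]sX; apply: symmetric_conj; exact: SK_sym.
Qed.

Lemma XSX_psd K X : Defs.symmetric X -> possemidef (X *m SK Qinf Rinf K *m X).
Proof. by move=> sX; rewrite -[X in _ *m X]sX; apply/psd_conj/posdef_psd/SK_posdef. Qed.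

Lemma qform_ric K X x : qform (ricK K X) x = qform (lyap (AK A B K) X) x +
  qform (beta ^- 2 *: (X *m SK Qinf Rinf K *m X)) x + qform (Bw *m Bw^T) x.
Proof. by rewrite ricE bilfDm bilfDm. Qed.

Lemma costE K X : \tr ((Q2 + K^T *m R2 *m K) *m X) = cost K X.
Proof.
rewrite mulmxDl mxtraceD; congr (_ + _).
by rewrite -!mulmxA mxtrace_mulC !mulmxA.
Qed.

(** At a kernel vector of X the Lyapunov term vanishes, and the positive definite W contradicts the
    inequality. *)
Lemma psd_ric_posdef K X : possemidef X -> negsemidef (ricK K X) -> posdef X.
Proof.
move=> pX hr; apply: posdef_psd_unit => // x Xx; apply/eqP; apply: contraT => x0.
have sX : Defs.symmetric X by case: pX.
have := nsd_le0 x hr; rewrite qform_ric (qform_lyap_ker _ sX Xx) add0r.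
have := posdef_gt0 hW x0; have := psd_ge0 x (psdZ (ltW beta2_gt0) (XSX_psd K sX)).
lra.
Qed.

(** On [Kbeta] the choice in [XK] is a genuine solution and not the default 0. The norm bounds gains
    on columns, whereas [riccati_exists] asks for rows, hence the passage through
    [csqn_gain_tr_lt]. *)
Lemma Kbeta_stab_sol K : Kbeta A B Bw Qih Rih beta K ->
  stab_sol A B Bw Qinf Rinf beta K (X_ K).
Proof.
move=> [hA hn]; rewrite /XK; apply: xgetPex.
have hg := hinf_norm_lt_gain hbeta hn.
have [|w y y0|X [sX ric hF]] := riccati_exists (C := outC K) (Bw := Bw) hA beta2_gt0.
- by rewrite -SKE; exact: SK_posdef.
- have := csqn_gain_tr_lt (exprn_gt0 2 hbeta) (hg w) y0.
  by rewrite ltr_pdivrMl ?exprn_gt0.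
exists X; split; first exact: sX.
split; first by rewrite ricE SKE.
by rewrite SKE.
Qed.

(** The equation makes the Lyapunov image of X equal to - beta^-2 X S X - W, hence negative, and A_K
    is Hurwitz. *)
Lemma stab_sol_posdef K X : Hurwitz (AK A B K) -> stab_sol A B Bw Qinf Rinf beta K X ->
  posdef X.
Proof.
move=> hA [sX [hr _]]; apply: (psd_ric_posdef (K := K)); last first.
  by rewrite hr; split=> [|x]; rewrite -/(bilf _ _ _) ?bilf0m // /Defs.symmetric trmx0.
apply: (Hurwitz_lyap_psd hA) => //; split; first exact: lyap_sym.
move=> x; rewrite -/(bilf _ _ _); have := congr1 (fun M => qform M x) hr.
rewrite /= qform_ric bilf0m.
have := psd_ge0 x (psdZ (ltW beta2_gt0) (XSX_psd K sX)); have := psd_ge0 x (posdef_psd hW).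
lra.
Qed.

(* With D := X - X_K, [lyap (A_K + beta^-2 X_K S) D = ric X - beta^-2 D S D <= 0]. *)
Lemma stab_sol_minimal K X0 X : stab_sol A B Bw Qinf Rinf beta K X0 -> Defs.symmetric X ->
  negsemidef (ricK K X) -> possemidef (X - X0).
Proof.
move=> [sX0 [h0 hF]] sX hX.
have sD : Defs.symmetric (X - X0) by apply: symmetricD => //; exact: symmetricN.
apply: (Hurwitz_lyap_psd hF) => //; split; first exact: lyap_sym.
move=> x; rewrite -/(bilf _ _ _).
have := nsd_le0 x hX; have := psd_ge0 x (psdZ (ltW beta2_gt0) (XSX_psd K sD)).
have -> : ricK K X = ricK K X0 + (lyap (AK A B K + beta ^- 2 *: (X0 *m SK Qinf Rinf K)) (X - X0)
    + beta ^- 2 *: ((X - X0) *m SK Qinf Rinf K *m (X - X0))).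
  by rewrite !ricE [in RHS]addrAC -(riccati_shift _ _ sX0 (SK_sym K) sD) subrKC.
rewrite h0 add0r bilfDm; lra.
Qed.

(** X itself certifies that A_K is Hurwitz. The margin e allows W to be scaled by some k > 1 in the
    inequality, so [riccati_gain] bounds the squared gain by beta^2 / k. *)
Lemma strict_ric_Kbeta K X e : posdef X -> 0 < e ->
  (forall x, qform (ricK K X) x <= - e * sqn x) -> Kbeta A B Bw Qih Rih beta K.
Proof.
move=> dX e0 he; have sX : Defs.symmetric X by case: dX.
have hA : Hurwitz (AK A B K).
  apply: (lyap_cert_Hurwitz (P := X)); split=> //; split.
    exact/symmetricN/lyap_sym.
  move=> x x0; rewrite -/(bilf _ _ _); have := he x; rewrite qform_ric bilfNm.
  have := psd_ge0 x (psdZ (ltW beta2_gt0) (XSX_psd K sX)); have := psd_ge0 x (posdef_psd hW).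
  have : 0 < e * sqn x by rewrite mulr_gt0 // sqn_gt0.
  lra.
split; first exact: hA.
pose c := 1 + n%:R * `|Bw *m Bw^T|.
have c0 : 0 < c by rewrite ltr_wpDr // mulr_ge0.
have ec : 0 < e / c by rewrite divr_gt0.
pose k := 1 + e / c.
have k1 : 1 < k by rewrite ltrDl.
have k0 : 0 < k by apply: lt_trans k1.
have hneg : negsemidef (lyap (AK A B K) X + beta ^- 2 *: (X *m ((outC K)^T *m outC K) *m X)
    + k *: (Bw *m Bw^T)).
  have -> : lyap (AK A B K) X + beta ^- 2 *: (X *m ((outC K)^T *m outC K) *m X)
    + k *: (Bw *m Bw^T) = ricK K X + (e / c) *: (Bw *m Bw^T).
    by rewrite ricE SKE -[RHS]addrA scalerDl scale1r.
  split; first by apply: symmetricD; [exact: ric_sym|apply: symmetricZ; case: hW].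
  move=> x; rewrite -/(bilf _ _ _) bilfDm bilfZm.
  have h1 : e / c * qform (Bw *m Bw^T) x <= e / c * (c * sqn x).
    rewrite ler_wpM2l ?(ltW ec) //; apply: le_trans (qform_le _ _) _.
    by rewrite ler_wpM2r ?sqn_ge0 // /c lerDr.
  rewrite mulrA divfK ?gt_eqF // in h1.
  have := he x; lra.
apply: (gain_hinf_norm_lt (k := beta ^+ 2 / k)) => //.
  by rewrite ltr_pdivrMr // ltr_pMr // exprn_gt0.
move=> w; apply: csqn_gain_tr_le; first by rewrite divr_gt0 ?exprn_gt0.
move=> y; have := riccati_gain hA sX beta2_gt0 hneg w y.
rewrite -ler_pdivlMl ?mulr_gt0 ?beta2_gt0 // => h; apply: le_trans h _.
by rewrite invfM invrK.
Qed.

Lemma epi_sub_lift K g : Kbeta A B Bw Qih Rih beta K ->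
  Jmix A B Bw Q2 R2 Qinf Rinf beta K <= g ->
  L_lft A B Bw Q2 R2 Qinf Rinf beta (K, g, X_ K).
Proof.
move=> hK hJ; have hs := Kbeta_stab_sol hK; have dX := stab_sol_posdef hK.1 hs.
split; first exact: dX.
split; first by rewrite -costE.
by have [_ [-> _]] := hs; split=> [|x]; rewrite -/(bilf _ _ _) ?bilf0m // /Defs.symmetric trmx0.
Qed.

(** Strictness puts K in [Kbeta], so X_K exists and is minimal; the difference of costs is the trace
    of a product of two semidefinite matrices. *)
Lemma strict_ric_Jmix K X e : posdef X -> 0 < e ->
  (forall x, qform (ricK K X) x <= - e * sqn x) ->
  Jmix A B Bw Q2 R2 Qinf Rinf beta K <= cost K X.
Proof.
move=> dX e0 he; have hK := strict_ric_Kbeta dX e0 he.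
have sX : Defs.symmetric X by case: dX.
have hD : possemidef (X - X_ K).
  apply: (stab_sol_minimal (Kbeta_stab_sol hK) sX); split; first exact: ric_sym.
  move=> x; rewrite -/(bilf _ _ _); apply: le_trans (he x) _.
  by rewrite mulNr oppr_le0 mulr_ge0 ?sqn_ge0 // ltW.
rewrite /Jmix -costE -subr_ge0 -raddfB -mulmxBr; apply: psd_mxtrace_mul_ge0 => //.
apply: psdD => //; rewrite -{2}[K]trmxK; exact/psd_conj/posdef_psd.
Qed.

(** Move from X_K along P, where P solves the closed-loop Lyapunov equation with right-hand side -I:
    the first-order gain -h I dominates the second-order term. *)
Lemma strictly_feasible K : Kbeta A B Bw Qih Rih beta K ->
  exists X, posdef X /\ exists2 e, 0 < e & forall x, qform (ricK K X) x <= - e * sqn x.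
Proof.
move=> hK; have hs := Kbeta_stab_sol hK; have dX := stab_sol_posdef hK.1 hs.
case: hs => sX [hr hF].
have [P sP eP] := lyap_solve_sym hF (symmetricN (symmetric1 n)).
have [h1 h10 hp1] := posdef_perturb dX sP.
(* The residual at X_K + h P is -h (I - h beta^-2 P S P); this h2 keeps the bracket definite. *)
have [h2 h20 hp2] := posdef_perturb (posdef1 n) (symmetricN (symmetricZ (beta ^- 2) (proj1 (XSX_psd K sP)))).
pose h := Num.min h1 h2.
have h0 : 0 < h by rewrite lt_min h10.
have hh1 : posdef (X_ K + h *: P) by apply: hp1; rewrite gtr0_norm // ge_min lexx.
exists (X_ K + h *: P); split=> //.
have := hp2 h; rewrite gtr0_norm // ge_min lexx orbT => /(_ isT) /posdef_lower_bound [e e0 he].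
exists (h * e); first by rewrite mulr_gt0.
move=> x; rewrite ricE (riccati_shift _ _ sX (SK_sym K) (symmetricZ h sP)).
rewrite addrAC -ricE hr add0r lyapZ eP -!scalemxAl -scalemxAr !bilfDm !bilfZm bilfNm.
have := he x; rewrite bilfDm bilfZm bilfNm bilfZm => g.
have := ler_wpM2l (ltW h0) g.
move: (qform (P *m _ *m _) x) (sqn x) (beta ^- 2) => a b c; lra.
Qed.

End Mixed.

(** * Linear matrix inequality, convexity, and closure of the epigraph *)

Section LiftedClosure.
Context {R : realType} {n m : nat}.
Variables (A : 'M[R]_n) (B : 'M[R]_(n, m)) (Bw : 'M[R]_n).
Variables (Q2 : 'M[R]_n) (R2 : 'M[R]_m) (Qinf Qih : 'M[R]_n) (Rinf Rih : 'M[R]_m).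
Variable beta : R.
Hypothesis hQih : possemidef Qih /\ Qih *m Qih = Qinf.
Hypothesis hRih : possemidef Rih /\ Rih *m Rih = Rinf.
Hypothesis hbeta : 0 < beta.
Hypothesis hQ2 : possemidef Q2.
Hypothesis hW : posdef (Bw *m Bw^T).
Hypothesis hQinf : posdef Qinf.
Hypothesis hR2 : posdef R2.

Local Notation outC K := (col_mx Qih (Rih *m K)).
Local Notation ricK := (ric A B Bw Qinf Rinf beta).
Local Notation cost K X := (\tr (Q2 *m X) + \tr (R2 *m K *m X *m K^T)).
Local Notation L := (L_lft A B Bw Q2 R2 Qinf Rinf beta).
Local Notation epi := (epi_Jmix A B Bw Q2 R2 Qinf Qih Rinf Rih beta).
Local Notation Fm := (Fcvx_mx A B Bw Qih Rih beta).

Definition lmi_out (X : 'M[R]_n) (Y : 'M[R]_(m, n)) := col_mx (Qih *m X) (Rih *m Y).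

Lemma qform_block p q (M : 'M[R]_p) (N : 'M[R]_(q, p)) (P : 'M[R]_q) x z :
  qform (block_mx M N^T N P) (col_mx x z) = qform M x + 2 * bilf N z x + qform P z.
Proof.
have add00 (U V : 'M[R]_1) : (U + V) 0 0 = U 0 0 + V 0 0 by rewrite mxE.
rewrite {1}/bilf -mulmxA mul_block_col tr_col_mx mul_row_col !mulmxDr !add00.
rewrite !mulmxA -!/(bilf _ _ _) (bilf_tr N); ring.
Qed.

Lemma Fcvx_mxE X Y : Defs.symmetric X -> Fm X Y =
  block_mx (A *m X + X *m A^T + B *m Y + Y^T *m B^T + Bw *m Bw^T) (lmi_out X Y)^T
    (lmi_out X Y) (- beta ^+ 2)%:M.
Proof.
move=> sX; rewrite /Fcvx_mx /lmi_out tr_col_mx !trmx_mul sX.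
by have [[-> _] _] := hQih; have [[-> _] _] := hRih.
Qed.

Lemma ric_lmi K X : Defs.symmetric X -> ricK K X =
  A *m X + X *m A^T + B *m (K *m X) + (K *m X)^T *m B^T + Bw *m Bw^T
  + beta ^- 2 *: ((lmi_out X (K *m X))^T *m lmi_out X (K *m X)).
Proof.
move=> sX; have -> : lmi_out X (K *m X) = outC K *m X.
  by rewrite /lmi_out mul_col_mx mulmxA.
rewrite [(col_mx _ _ *m X)^T]trmx_mul sX [_ *m (col_mx _ _ *m X)]mulmxA -(mulmxA X _ (col_mx _ _)) -(SKE hQih hRih) ricE [in RHS]addrAC.
congr (_ + _ + _).
rewrite /lyap /AK linearD /= mulmxDl mulmxDr !trmx_mul sX !mulmxA.
by rewrite -!addrA; congr (_ + _); rewrite addrCA.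
Qed.

Lemma qform_scalar p (a : R) (x : 'cV[R]_p) : qform a%:M x = a * sqn x.
Proof. by rewrite -[a%:M]scalemx1 bilfZm. Qed.

Lemma qform_Fcvx X Y x z : Defs.symmetric X -> qform (Fm X Y) (col_mx x z) =
  qform (A *m X + X *m A^T + B *m Y + Y^T *m B^T + Bw *m Bw^T) x
  + 2 * bilf 1%:M z (lmi_out X Y *m x) - beta ^+ 2 * sqn z.
Proof. by move=> sX; rewrite Fcvx_mxE // qform_block qform_scalar bilf1_mulr mulNr. Qed.

(** Schur complement taken pointwise: the block form is concave in z, and completing the square
    bounds it by the Riccati form. *)
Lemma qform_Fcvx_le K X x z : Defs.symmetric X ->
  qform (Fm X (K *m X)) (col_mx x z) <= qform (ricK K X) x.
Proof.
move=> sX; rewrite qform_Fcvx // ric_lmi // [leRHS]bilfDm -addrA lerD2l bilfZm qform_gram.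
set v := lmi_out _ _ *m x.
have := sqn_ge0 (beta^-1 *: v - beta *: z).
rewrite -scaleNr !(bilfDl, bilfDr, bilfZl, bilfZr) (bilf_sym v z (symmetric1 _)).
rewrite -exprVn; have : beta * beta^-1 = 1 by rewrite mulfV ?gt_eqF.
move: (beta^-1) (sqn v) (sqn z) (bilf 1%:M z v) => b s1 s2 s3 e h.
have : 0 <= b ^+ 2 * s1 - 2 * (beta * b) * s3 + beta ^+ 2 * s2.
  by move: h; congr (_ <= _); ring.
rewrite e; lra.
Qed.

(** The bound of [qform_Fcvx_le] is attained at the maximiser z = beta^-2 v, where v is
    [lmi_out X (K *m X) *m x]. *)
Lemma qform_Fcvx_eq K X x : Defs.symmetric X ->
  exists z, qform (Fm X (K *m X)) (col_mx x z) = qform (ricK K X) x.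
Proof.
move=> sX; exists (beta ^- 2 *: (lmi_out X (K *m X) *m x)).
rewrite qform_Fcvx // ric_lmi // [RHS]bilfDm [in RHS]bilfZm qform_gram !(bilfZl, bilfZr).
by field; rewrite gt_eqF.
Qed.

Lemma Fcvx_sym X Y : Defs.symmetric X -> Defs.symmetric (Fm X Y).
Proof.
move=> sX; rewrite Fcvx_mxE // /Defs.symmetric tr_block_mx trmxK tr_scalar_mx; congr block_mx.
rewrite !linearD /= !trmx_mul !trmxK sX; congr (_ + _).
by rewrite -!addrA addrCA; congr (_ + (_ + _)); rewrite addrC.
Qed.

Lemma Fcvx_nsdP K X : Defs.symmetric X ->
  negsemidef (Fm X (K *m X)) <-> negsemidef (ricK K X).
Proof.
move=> sX; split=> h; (split=> [|x]; first by [exact: Fcvx_sym|exact: (ric_sym A B beta hRih hW hQinf _ sX)]).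
  by rewrite -/(bilf _ _ _); have [z <-] := qform_Fcvx_eq K x sX; exact: nsd_le0.
rewrite -/(bilf _ _ _) -[x]vsubmxK; apply: le_trans (qform_Fcvx_le _ _ _ sX) _; exact: nsd_le0.
Qed.

(** The coefficients sum to 1, so the constant blocks W and -beta^2 I are reproduced. The Riccati
    expression has no such property in (K, X). *)
Lemma Fcvx_affine X Y X1 Y1 (t : R) :
  Fm ((1 - t) *: X + t *: X1) ((1 - t) *: Y + t *: Y1) = (1 - t) *: Fm X Y + t *: Fm X1 Y1.
Proof.
rewrite /Fcvx_mx !scale_block_mx add_block_mx.
rewrite !scale_row_mx !scale_col_mx add_row_mx add_col_mx [(_ + _)^T]linearD /=.
rewrite ![(_ *: _)^T]linearZ /= !mulmxDl !mulmxDr -!scalemxAl -!scalemxAr; congr block_mx; last first.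
  by rewrite -scalerDl subrK scale1r.
by apply/matrixP => i j; rewrite !mxE; ring.
Qed.

(** At the maximiser z for (Kt, Xt) the block form is a convex combination of two block forms, each
    below its own Riccati form: one is nonpositive, the other carries the margin e with weight t. *)
Lemma convex_strict_ric K X K1 X1 e t : Defs.symmetric X -> Defs.symmetric X1 ->
  negsemidef (ricK K X) -> (forall x, qform (ricK K1 X1) x <= - e * sqn x) ->
  0 < t <= 1 -> forall Xt Kt, Xt = (1 - t) *: X + t *: X1 ->
  Kt *m Xt = (1 - t) *: (K *m X) + t *: (K1 *m X1) ->
  forall x, qform (ricK Kt Xt) x <= - (t * e) * sqn x.
Proof.
move=> sX sX1 hr he /andP[t0 t1] Xt Kt eX eY x.
have sXt : Defs.symmetric Xt by rewrite eX; apply: symmetricD; exact: symmetricZ.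
have [z <-] := qform_Fcvx_eq Kt x sXt.
rewrite eY eX Fcvx_affine bilfDm !bilfZm.
have h1 := le_trans (qform_Fcvx_le K x z sX) (nsd_le0 x hr).
have h2 := le_trans (qform_Fcvx_le K1 x z sX1) (he x).
have h3 : (1 - t) * qform (Fm X (K *m X)) (col_mx x z) <= 0.
  by rewrite mulr_ge0_le0 // subr_ge0.
have := ler_wpM2l (ltW t0) h2; lra.
Qed.

Lemma closure_cvg_pair (U V : topologicalType) (E : set (U * V)) (f : R -> U)
    (h : R -> V) a b : f t @[t --> (0 : R)^'+] --> a -> h t @[t --> (0 : R)^'+] --> b ->
  (\forall t \near (0 : R)^'+, E (f t, h t)) -> closure E (a, b).
Proof.
move=> fa hb hE; have := cvg_pair fa hb => hc W /hc hW'.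
have {}hW' : \forall t \near (0 : R)^'+, W (f t, h t) := hW'.
have [t [Et Wt]] := @filter_ex _ _ (at_right_proper_filter 0) _ (filterI hE hW').
by exists (f t, h t).
Qed.

(** Move along the segment in (X, Y) towards a strictly feasible point. Each point with t > 0 is
    strictly feasible, hence gives an element of the epigraph, and t -> 0 recovers (K, g). *)
Lemma lift_sub_closure : (exists K, Kbeta A B Bw Qih Rih beta K) ->
  proj_Kg L `<=` closure epi.
Proof.
move=> [K1 hK1] [K g] [X [dX [hc hr]]]; rewrite /= in hc hr.
have [X1 [dX1 [e e0 he]]] := strictly_feasible hQih hRih hbeta hW hQinf hK1.
have sX : Defs.symmetric X by case: dX.
have sX1 : Defs.symmetric X1 by case: dX1.
pose Xt (t : R) := (1 - t) *: X + t *: X1.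
pose Yt (t : R) := (1 - t) *: (K *m X) + t *: (K1 *m X1).
pose Kt (t : R) := Yt t *m invmx (Xt t).
(* Correcting g by the change of cost keeps [gt t] above the cost at (Kt, Xt), because
   [cost K X <= g], and still tends to g. *)
pose gt (t : R) := g + (cost (Kt t) (Xt t) - cost K X).
have c0 : t @[t --> (0 : R)^'+] --> (0 : R) by exact: (cvg_at_right_filter cvg_id).
have c1 : 1 - t @[t --> (0 : R)^'+] --> (1 : R).
  by rewrite -[X in _ --> X](subr0 (1 : R)); exact: (cvgB (cvg_cst (1 : R)) c0).
have cX : Xt t @[t --> (0 : R)^'+] --> X.
  rewrite -[X in _ --> X](_ : 1 *: X + 0 *: X1 = _); last by rewrite scale1r scale0r addr0.
  by apply: cvg_addmx; apply: cvg_scalemx => //; exact: cvg_cst.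
have cY : Yt t @[t --> (0 : R)^'+] --> K *m X.
  rewrite -[X in _ --> X](_ : 1 *: (K *m X) + 0 *: (K1 *m X1) = _); last by rewrite scale1r scale0r addr0.
  by apply: cvg_addmx; apply: cvg_scalemx => //; exact: cvg_cst.
have cK : Kt t @[t --> (0 : R)^'+] --> K.
  rewrite -[X in _ --> X](mulmxK (posdef_unit dX) K); apply: cvg_mulmx => //.
  by apply: cvg_invmx => //; exact: posdef_unit.
have cg : gt t @[t --> (0 : R)^'+] --> g.
  rewrite -[X in _ --> X](_ : g + (cost K X - cost K X) = _); last by rewrite subrr addr0.
  apply: cvgD; first exact: cvg_cst.
  apply: cvgB; last exact: cvg_cst.
  apply: cvgD; apply: cvg_mxtrace; first by apply: cvg_mulmx => //; exact: cvg_cst.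
  apply: cvg_mulmx; last exact: cvg_trmx.
  by apply: cvg_mulmx => //; apply: cvg_mulmx => //; exact: cvg_cst.
apply: (closure_cvg_pair cK cg).
near=> t.
have t0 : 0 < t by near: t; exact: nbhs_right_gt.
have t1 : t <= 1 by near: t; exact: nbhs_right_le.
have dXt : posdef (Xt t).
  rewrite /Xt addrC; apply: posdef_psdD; first exact: posdefZ.
  by apply: psdZ; [rewrite subr_ge0|exact: posdef_psd].
have hs : forall x, qform (ricK (Kt t) (Xt t)) x <= - (t * e) * sqn x.
  apply: (convex_strict_ric sX sX1 hr he) => //; first by rewrite t0.
  by rewrite /Kt mulmxKV // posdef_unit.
have te : 0 < t * e by rewrite mulr_gt0.
split; first exact: (strict_ric_Kbeta hQih hRih hbeta hW hQinf dXt te hs).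
apply: le_trans (strict_ric_Jmix hQih hRih hbeta hQ2 hW hQinf hR2 dXt te hs) _.
by rewrite /gt /= addrCA lerDl subr_ge0.
Unshelve. all: by end_near. Qed.

Lemma frobE p q (M : 'M[R]_(p, q)) : frob M = \tr (M *m M^T).
Proof.
by apply: eq_bigr => i _; rewrite mxE; apply: eq_bigr => j _; rewrite mxE expr2.
Qed.

Lemma closed_lift : closed (proj_Kg L).
Proof.
(* Definiteness of X is relaxed to semidefiniteness to make every clause closed; [psd_ric_posdef]
   restores it in [CP]. *)
pose C (kg : 'M[R]_(m, n) * R) (X : 'M[R]_n) := [/\ X^T - X = 0,
  forall x, 0 <= qform X x, 0 <= kg.2 - cost kg.1 X & forall x, 0 <= - qform (ricK kg.1 X) x].
have CP kg X : C kg X <-> L (kg.1, kg.2, X).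
  split=> [[/eqP + h1 h2 h3]|[dX [hc hr]]].
    rewrite subr_eq0 => /eqP sX.
    have hr : negsemidef (ricK kg.1 X).
      split; first exact: (ric_sym A B beta hRih hW hQinf).
      by move=> x; rewrite -oppr_ge0; exact: h3.
    split; last by split=> //; rewrite -subr_ge0.
    by apply: (psd_ric_posdef hRih hbeta hW hQinf _ hr); split.
  have sX : Defs.symmetric X by case: dX.
  split; rewrite ?subr_ge0 //; first by rewrite sX subrr.
    by move=> x; apply/psd_ge0/posdef_psd.
  by move=> x; rewrite oppr_ge0 nsd_le0.
have -> : proj_Kg L = [set kg | exists X, C kg X].
  by apply/seteqP; split=> kg [X] /CP h; exists X.
have c1 (x : 'M[R]_(m, n) * R * 'M[R]_n) : y.1.1 @[y --> x] --> x.1.1.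
  by apply: (cvg_comp fst fst); exact: cvg_fst.
have c2 (x : 'M[R]_(m, n) * R * 'M[R]_n) : y.1.2 @[y --> x] --> x.1.2.
  by apply: (cvg_comp fst snd); [exact: cvg_fst|exact: cvg_snd].
have c3 (x : 'M[R]_(m, n) * R * 'M[R]_n) : y.2 @[y --> x] --> x.2 by exact: cvg_snd.
apply: closed_proj_bounded.
  rewrite (_ : mkset _ = [set x : 'M[R]_(m, n) * R * 'M[R]_n | x.2^T - x.2 = 0] `&`
    (\bigcap_(v in setT) [set x : 'M[R]_(m, n) * R * 'M[R]_n | 0 <= qform x.2 v] `&`
    ([set x : 'M[R]_(m, n) * R * 'M[R]_n | 0 <= x.1.2 - cost x.1.1 x.2] `&`
    \bigcap_(v in setT) [set x : 'M[R]_(m, n) * R * 'M[R]_n | 0 <= - qform (ricK x.1.1 x.2) v]))); last first.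
    apply/seteqP; split=> x; first by move=> [h1 h2 h3 h4]; split=> //; split=> [v _|]; [exact: h2|split=> // v _; exact: h4].
    by move=> [h1 [h2 [h3 h4]]]; split=> // v; [exact: h2|exact: h4].
  apply: closedI; [|apply: closedI; [|apply: closedI]].
  - by apply: closed_mx_eq0 => x; exact: (cvgB (cvg_trmx (FF := nbhs_filter x) (c3 x)) (c3 x)).
  - apply: closed_bigI => v _; apply: closed_fge0 => x.
    exact: (@cvg_bilf R _ (nbhs x) _ n n _ _ v v (c3 x)).
  - apply: closed_fge0 => x; apply: (cvgB (c2 x)).
    apply: (@cvgD _ _ _ (nbhs x)); apply: (@cvg_mxtrace R _ (nbhs x)).
      by apply: cvg_mulmx; [exact: cvg_cst|exact: c3].
    apply: cvg_mulmx; last by apply: cvg_trmx; exact: c1.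
    by apply: cvg_mulmx; last exact: c3; apply: cvg_mulmx; [exact: cvg_cst|exact: c1].
  - apply: closed_bigI => v _; apply: closed_fge0 => x; apply: (@cvgN _ _ _ (nbhs x)).
    apply: (@cvg_bilf R _ (nbhs x)).
    have cA : AK A B y.1.1 @[y --> x] --> AK A B x.1.1.
      apply: (@cvg_addmx R _ (nbhs x)); first exact: cvg_cst.
      by apply: cvg_mulmx; [exact: cvg_cst|exact: c1].
    have cS : SK Qinf Rinf y.1.1 @[y --> x] --> SK Qinf Rinf x.1.1.
      apply: (@cvg_addmx R _ (nbhs x)); first exact: cvg_cst.
      apply: cvg_mulmx; last exact: c1.
      by apply: cvg_mulmx; [apply: cvg_trmx; exact: c1|exact: cvg_cst].
    rewrite /ric; apply: (@cvg_addmx R _ (nbhs x)); last exact: cvg_cst.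
    apply: (@cvg_addmx R _ (nbhs x)).
      apply: (@cvg_addmx R _ (nbhs x)); apply: cvg_mulmx; [exact: cA|exact: c3|exact: c3|].
      exact: (cvg_trmx (FF := nbhs_filter x) cA).
    apply: (@cvg_scalemx R _ (nbhs x) _ n n (fun=> beta ^- 2)); first exact: cvg_cst.
    by apply: cvg_mulmx; [apply: cvg_mulmx; [exact: c3|]|exact: c3].
move=> kg0.
have [q q0 hq] := posdef_lower_bound hQinf.
(* The extra 1 next to [frob] absorbs the variation of A_K near kg0, so one bound serves a whole
   neighbourhood; S >= Qinf makes q independent of K. *)
exists (1 + 4 * (frob (AK A B kg0.1) + 1) / (beta ^- 2 * q) ^+ 2).
have cf : frob (AK A B y.1) @[y --> kg0] --> frob (AK A B kg0.1).
  have cA : AK A B y.1 @[y --> kg0] --> AK A B kg0.1.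
    apply: (@cvg_addmx R _ (nbhs kg0)); first exact: cvg_cst.
    by apply: cvg_mulmx; [exact: cvg_cst|exact: cvg_fst].
  under eq_cvg do rewrite frobE; rewrite frobE; apply: (@cvg_mxtrace R _ (nbhs kg0)).
  by apply: cvg_mulmx => //; exact: cvg_trmx.
have : \forall y \near kg0, frob (AK A B y.1) < frob (AK A B kg0.1) + 1.
  by apply: (cvgr_lt _ cf); rewrite ltrDl.
apply: filterS => kg hkg X /CP[dX [_ hr]] i j.
apply: le_trans (frob_entry _ _ _) _; rewrite lerD2l.
have sX : Defs.symmetric X by case: dX.
have b2 := beta2_gt0 hbeta.
apply: (le_trans (y := 4 * frob (AK A B kg.1) / (beta ^- 2 * q) ^+ 2)).
  apply: (riccati_frob_bound b2 q0 _ sX (posdef_psd hW) hr) => x.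
  apply: le_trans (hq x) _; rewrite /SK bilfDm lerDl; apply: psd_ge0.
  rewrite -{2}[kg.1]trmxK; apply: psd_conj.
  by rewrite -hRih.2; have [[e _] _] := hRih; rewrite -{2}e; exact: psd_gram.
by rewrite ler_wpM2r ?invr_ge0 ?exprn_ge0 ?mulr_ge0 ?(ltW b2) ?(ltW q0) // ler_wpM2l // ltW.
Qed.

End LiftedClosure.

(** * Calculus of functions of class C^k on an open set *)

Section SmoothCalculus.
Context {R : realType} {U : normedModType R}.
Implicit Types (V : normedModType R) (O : set U).

(** As O is open, f and g agree near each of its points, so their limits and directional derivatives
    coincide. *)
Lemma Ck_ext V k O (f g : U -> V) : open O -> (forall x, O x -> f x = g x) ->
  Ck k O f -> Ck k O g.
Proof.
move=> oO; elim: k f g => [|k IH] f g fg.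
  move=> hf x Ox; rewrite /prop_for /continuous_at -fg //.
  apply: cvg_trans (hf x Ox); apply: near_eq_cvg.
  by have := open_nbhs_nbhs (conj oO Ox); apply: filterS => y; exact: fg.
have nfg x : O x -> \forall y \near x, f y = g y.
  by move=> Ox; have := open_nbhs_nbhs (conj oO Ox); apply: filterS => y; exact: fg.
move=> [cf df]; split.
  move=> x Ox; rewrite /prop_for /continuous_at -fg //.
  by apply: cvg_trans (cf x Ox); apply: near_eq_cvg; exact: nfg.
move=> v; have [dv Dv] := df v; split=> [x Ox|].
  by apply: near_eq_derivable (dv x Ox); exact: nfg.
by apply: IH Dv => x Ox; apply: near_eq_derive; exact: nfg.
Qed.

Lemma Ck_pred V k O (f : U -> V) : Ck k.+1 O f -> Ck k O f.
Proof.
elim: k f => [|k IH] f; first by case.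
by move=> [cf df]; split=> // v; have [dv Dv] := df v; split=> //; exact: IH.
Qed.

Lemma Ck_cst V k O (a : V) : Ck k O (fun=> a).
Proof.
elim: k a => [|k IH] a; first by move=> x _; exact: cvg_cst.
split=> [x _|v]; first exact: cvg_cst.
split=> [x _|]; first exact: derivable_cst.
rewrite (_ : (fun x => 'D_v (fun=> a) x) = fun=> 0) //.
by apply/funext => x; exact: derive_cst.
Qed.

Lemma is_derive_linear V (f : U -> V) : (forall a u w, f (a *: u + w) = a *: f u + f w) ->
  forall x v, is_derive x v f (f v).
Proof.
move=> hf x v.
have h : h^-1 *: ((f \o shift x) (h *: v) - f x) @[h --> 0^'] --> f v.
  apply: (cvg_trans (G := (fun=> f v) x @[x --> 0^'])); last exact: cvg_cst.
  apply: near_eq_cvg; near=> h.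
  have h0 : h != 0 by near: h; exact: nbhs_dnbhs_neq.
  by rewrite /= hf addrK scalerA mulVf // scale1r.
by apply: DeriveDef; [apply/cvg_ex; exists (f v)|apply: cvg_lim h].
Unshelve. all: by end_near. Qed.

Lemma Ck_linear V k O (f : U -> V) : (forall a u w, f (a *: u + w) = a *: f u + f w) ->
  continuous f -> Ck k O f.
Proof.
move=> hf cf; case: k => [|k] /=; first by move=> x _; exact: cf.
split=> [x _|v]; first exact: cf.
have d := is_derive_linear hf; split=> [x _|]; first by case: (d x v).
rewrite (_ : (fun x => 'D_v f x) = fun=> f v); first exact: Ck_cst.
by apply/funext => x; case: (d x v).
Qed.

Lemma CkD V k O (f g : U -> V) : open O -> Ck k O f -> Ck k O g ->
  Ck k O (fun x => f x + g x).
Proof.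
move=> oO; elim: k f g => [|k IH] f g.
  by move=> cf cg x Ox; apply: cvgD; [exact: cf|exact: cg].
move=> [cf df] [cg dg]; split=> [x Ox|v].
  by apply: cvgD; [exact: cf|exact: cg].
have [df1 Df] := df v; have [dg1 Dg] := dg v.
split=> [x Ox|]; first by apply: derivableD; [exact: df1|exact: dg1].
apply: (Ck_ext oO _ (IH _ _ Df Dg)) => x Ox /=.
by rewrite -deriveD //; [exact: df1|exact: dg1].
Qed.

Lemma CkM k O (f g : U -> R) : open O -> Ck k O f -> Ck k O g ->
  Ck k O (fun x => f x * g x).
Proof.
move=> oO; elim: k f g => [|k IH] f g.
  by move=> cf cg x Ox; apply: cvgM; [exact: cf|exact: cg].
move=> hf hg; have hf' := Ck_pred hf; have hg' := Ck_pred hg.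
case: hf => cf df; case: hg => cg dg; split=> [x Ox|v].
  by apply: cvgM; [exact: cf|exact: cg].
have [df1 Df] := df v; have [dg1 Dg] := dg v.
split=> [x Ox|]; first by apply: derivableM; [exact: df1|exact: dg1].
apply: (Ck_ext oO _ (CkD oO (IH _ _ hf' Dg) (IH _ _ hg' Df))) => x Ox /=.
by rewrite -[RHS]/('D_v (f * g) x) deriveM //; [exact: df1|exact: dg1].
Qed.

(** The derivative is - f^-2 times that of f, a product of functions already known to be of class k
    by induction. *)
Lemma CkV k O (f : U -> R) : open O -> (forall x, O x -> f x != 0) -> Ck k O f ->
  Ck k O (fun x => (f x)^-1).
Proof.
move=> oO f0; elim: k => [|k IH].
  by move=> cf x Ox; apply: cvgV; [exact: f0|exact: cf].
move=> hf; have hi := IH (Ck_pred hf); case: hf => cf df; split=> [x Ox|v].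
  by apply: cvgV; [exact: f0|exact: cf].
have [df1 Df] := df v.
split=> [x Ox|]; first by apply: derivableV; [exact: f0|exact: df1].
have h := CkM oO (Ck_cst k O (-1 : R)) (CkM oO (CkM oO hi hi) Df).
apply: (Ck_ext oO _ h) => x Ox /=.
rewrite deriveV; [|exact: f0|exact: df1].
by rewrite -exprVn expr2 mulN1r scaleNr.
Qed.

Lemma Ck_sum k O (I : Type) (r : seq I) (P : pred I) (f : I -> U -> R) : open O ->
  (forall i, Ck k O (f i)) -> Ck k O (fun x => \sum_(i <- r | P i) f i x).
Proof.
move=> oO hf; elim: r => [|i r IH].
  by rewrite (_ : (fun x => _) = fun=> 0); [exact: Ck_cst|apply/funext => x; rewrite big_nil].
rewrite (_ : (fun x => _) = fun x => if P i then f i x + \sum_(j <- r | P j) f j x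
  else \sum_(j <- r | P j) f j x); last by apply/funext => x; rewrite big_cons.
by case: (P i) => //; exact: CkD.
Qed.

Lemma Ck_prod k O (I : Type) (r : seq I) (P : pred I) (f : I -> U -> R) : open O ->
  (forall i, Ck k O (f i)) -> Ck k O (fun x => \prod_(i <- r | P i) f i x).
Proof.
move=> oO hf; elim: r => [|i r IH].
  by rewrite (_ : (fun x => _) = fun=> 1); [exact: Ck_cst|apply/funext => x; rewrite big_nil].
rewrite (_ : (fun x => _) = fun x => if P i then f i x * \prod_(j <- r | P j) f j x
  else \prod_(j <- r | P j) f j x); last by apply/funext => x; rewrite big_cons.
by case: (P i) => //; exact: CkM.
Qed.

Lemma Ck_mx k O p q (f : U -> 'M[R]_(p, q)) : open O ->
  (forall i j, Ck k O (fun x => f x i j)) -> Ck k O f.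
Proof.
move=> oO; elim: k f => [|k IH] f hf.
  by move=> x Ox; apply: (cvg_mx (FF := nbhs_filter x)) => i j; exact: hf.
split=> [x Ox|v].
  by apply: (cvg_mx (FF := nbhs_filter x)) => i j; case: (hf i j) => + _; exact.
have dv x : O x -> derivable f x v.
  by move=> Ox; apply/derivable_mxP => i j; case: (hf i j) => _ /(_ v)[+ _]; exact.
split=> //; apply: IH => i j.
case: (hf i j) => _ /(_ v)[_ h]; apply: (Ck_ext oO _ h) => x Ox.
by rewrite derive_mx ?mxE //; exact: dv.
Qed.

Lemma is_derive_pair V1 V2 (f : U -> V1) (g : U -> V2) x v : derivable f x v ->
  derivable g x v -> is_derive x v (fun y => (f y, g y)) ('D_v f x, 'D_v g x).
Proof.
move=> df dg.
have h : h^-1 *: (((fun y => (f y, g y)) \o shift x) (h *: v) - (f x, g x)) @[h --> 0^']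
    --> ('D_v f x, 'D_v g x) by exact: (cvg_pair df dg).
by apply: DeriveDef; [apply/cvg_ex; exists ('D_v f x, 'D_v g x)|apply: cvg_lim h].
Qed.

Lemma Ck_pair V1 V2 k O (f : U -> V1) (g : U -> V2) : open O ->
  Ck k O f -> Ck k O g -> Ck k O (fun x => (f x, g x)).
Proof.
move=> oO; elim: k f g => [|k IH] f g.
  by move=> cf cg x Ox; apply: cvg_pair; [exact: cf|exact: cg].
move=> [cf df] [cg dg]; split=> [x Ox|v].
  by apply: cvg_pair; [exact: cf|exact: cg].
have [df1 Df] := df v; have [dg1 Dg] := dg v.
have d x : O x -> is_derive x v (fun y => (f y, g y)) ('D_v f x, 'D_v g x).
  by move=> Ox; apply: is_derive_pair; [exact: df1|exact: dg1].
split=> [x /d[]//|].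
by apply: (Ck_ext oO _ (IH _ _ Df Dg)) => x /d[].
Qed.

Lemma Ck_mulmx k O p q r (f : U -> 'M[R]_(p, q)) (g : U -> 'M[R]_(q, r)) : open O ->
  (forall i j, Ck k O (fun x => f x i j)) -> (forall i j, Ck k O (fun x => g x i j)) ->
  forall i j, Ck k O (fun x => (f x *m g x) i j).
Proof.
move=> oO hf hg i j; rewrite (_ : (fun x => _) = fun x => \sum_l f x i l * g x l j).
  by apply: Ck_sum => // l; exact: CkM.
by apply/funext => x; rewrite mxE.
Qed.

Lemma Ck_det k O p (f : U -> 'M[R]_p) : open O ->
  (forall i j, Ck k O (fun x => f x i j)) -> Ck k O (fun x => \det (f x)).
Proof.
move=> oO hf; apply: Ck_sum => // s; apply: CkM => //; first exact: Ck_cst.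
exact: Ck_prod.
Qed.

Lemma Ck_invmx k O p (f : U -> 'M[R]_p) : open O -> (forall x, O x -> \det (f x) != 0) ->
  (forall i j, Ck k O (fun x => f x i j)) ->
  forall i j, Ck k O (fun x => invmx (f x) i j).
Proof.
move=> oO f0 hf i j.
have h : Ck k O (fun x => (\det (f x))^-1 * cofactor (f x) j i).
  apply: CkM => //; first by apply: CkV => //; exact: Ck_det.
  apply: CkM => //; first exact: Ck_cst.
  apply: Ck_det => // a b; rewrite (_ : (fun x => _) = fun x => f x (lift j a) (lift i b)) //.
  by apply/funext => x; rewrite !mxE.
apply: (Ck_ext oO _ h) => x Ox.
by rewrite /invmx unitmxE unitfE f0 // !mxE.
Qed.

End SmoothCalculus.

(** * Smoothness of the change of variables and of its inverse *)

Section Diffeomorphism.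
Context {R : realType} {n m : nat}.

(** The map is polynomial in the entries, so it serves as its own smooth extension to the whole
    space. *)
Lemma Phi_smooth (S : set ('M[R]_(m, n) * R * 'M[R]_n)) : smooth_on S (@Phi R n m).
Proof.
move=> p Sp; exists setT, (@Phi R n m); split=> //; split=> //; split=> [|k].
  exact: openT.
rewrite (_ : @Phi R n m = fun p => (p.1.2, p.2, p.1.1 *m p.2)); last by apply/funext => -[[]].
have c1 : continuous (fun x : 'M[R]_(m, n) * R * 'M[R]_n => x.1.1).
  by move=> x; apply: (cvg_comp fst fst); exact: cvg_fst.
have c2 : continuous (fun x : 'M[R]_(m, n) * R * 'M[R]_n => x.1.2).
  by move=> x; apply: (cvg_comp fst snd); [exact: cvg_fst|exact: cvg_snd].
have c3 : continuous (fun x : 'M[R]_(m, n) * R * 'M[R]_n => x.2).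
  by move=> x; exact: cvg_snd.
apply: Ck_pair; first exact: openT.
  by apply: Ck_pair; [exact: openT|exact: Ck_linear|exact: Ck_linear].
apply: Ck_mx; first exact: openT.
apply: Ck_mulmx => [|i j|i j]; first exact: openT.
- apply: Ck_linear => [a u w|x]; first by rewrite /= !mxE.
  by apply: (cvg_mx_entry (F := nbhs x)); exact: c1.
- apply: Ck_linear => [a u w|x]; first by rewrite /= !mxE.
  by apply: (cvg_mx_entry (F := nbhs x)); exact: c3.
Qed.

(** S need not be open, so smoothness is shown on the open set where det X is nonzero, on which the
    inverse matrix is rational in the entries. *)
Lemma Phi_inv_smooth (S : set (R * 'M[R]_n * 'M[R]_(m, n))) :
  (forall q, S q -> \det q.1.2 != 0) ->
  smooth_on S (fun q => (q.2 *m invmx q.1.2, q.1.1, q.1.2)).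
Proof.
move=> hS q Sq.
have c1 : continuous (fun x : R * 'M[R]_n * 'M[R]_(m, n) => x.1.1).
  by move=> x; apply: (cvg_comp fst fst); exact: cvg_fst.
have c2 : continuous (fun x : R * 'M[R]_n * 'M[R]_(m, n) => x.1.2).
  by move=> x; apply: (cvg_comp fst snd); [exact: cvg_fst|exact: cvg_snd].
have c3 : continuous (fun x : R * 'M[R]_n * 'M[R]_(m, n) => x.2).
  by move=> x; exact: cvg_snd.
have cd : continuous (fun x : R * 'M[R]_n * 'M[R]_(m, n) => \det x.1.2).
  by move=> x; apply: (cvg_det (FF := nbhs_filter x)); exact: c2.
pose W := [set x : R * 'M[R]_n * 'M[R]_(m, n) | \det x.1.2 != 0].
have oW : open W.
  rewrite -[W]setCK openC (_ : ~` W = [set x | \det x.1.2 = 0]); first exact: closed_feq0.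
  by apply/seteqP; split=> x /=; [move=> /negP; rewrite negbK => /eqP|move=> h; rewrite /setC /W /= h eqxx].
exists W, (fun q => (q.2 *m invmx q.1.2, q.1.1, q.1.2)).
split; first exact: hS.
split=> //; split=> // k.
have l2 i j : Ck k W (fun x : R * 'M[R]_n * 'M[R]_(m, n) => x.1.2 i j).
  apply: Ck_linear => [a u w|x]; first by rewrite /= !mxE.
  by apply: (cvg_mx_entry (F := nbhs x)); exact: c2.
have l3 i j : Ck k W (fun x : R * 'M[R]_n * 'M[R]_(m, n) => x.2 i j).
  apply: Ck_linear => [a u w|x]; first by rewrite /= !mxE.
  by apply: (cvg_mx_entry (F := nbhs x)); exact: c3.
apply: Ck_pair => //; last exact: Ck_linear.
apply: Ck_pair => //; last exact: Ck_linear.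
by apply: Ck_mx => //; apply: Ck_mulmx => //; exact: Ck_invmx.
Qed.

End Diffeomorphism.
Unset Implicit Arguments.
Theorem theorem6 (R : realType) (n m : nat)
  (A : 'M[R]_n) (B : 'M[R]_(n, m)) (Bw : 'M[R]_n)
  (Q2 Q2h : 'M[R]_n) (R2 : 'M[R]_m) (Qinf Qih : 'M[R]_n) (Rinf Rih : 'M[R]_m)
  (beta : R)
  (* Q2h, Qih, Rih are the positive semidefinite square roots of Q2, Qinf, Rinf *)
  (hQ2h : possemidef Q2h /\ Q2h *m Q2h = Q2)
  (hQih : possemidef Qih /\ Qih *m Qih = Qinf)
  (hRih : possemidef Rih /\ Rih *m Rih = Rinf)
  (hbeta : 0 < beta)
  (* Assumption 1 *)
  (hstab : stabilizable A B)
  (hdet : detectable Q2h A)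
  (hinf : (ereal_inf [set hinf_norm A B Bw Qih Rih K | K in Kstab A B] < beta%:E)%E)
  (* Assumption 2 *)
  (hQ2 : possemidef Q2) (hW : posdef (Bw *m Bw^T))
  (hQinf : posdef Qinf) (hR2 : posdef R2) (hRinf : posdef Rinf) :
  (epi_Jmix A B Bw Q2 R2 Qinf Qih Rinf Rih beta
     `<=` proj_Kg (L_lft A B Bw Q2 R2 Qinf Rinf beta) /\
   proj_Kg (L_lft A B Bw Q2 R2 Qinf Rinf beta)
     = closure (epi_Jmix A B Bw Q2 R2 Qinf Qih Rinf Rih beta)) /\
  diffeomorphism_onto (L_lft A B Bw Q2 R2 Qinf Rinf beta)
    (F_cvx A B Bw Q2 R2 Qih Rih beta) (@Phi R n m).
Proof.
have epi_sub : epi_Jmix A B Bw Q2 R2 Qinf Qih Rinf Rih beta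
    `<=` proj_Kg (L_lft A B Bw Q2 R2 Qinf Rinf beta).
  move=> [K g] [hK hJ]; exists (XK A B Bw Qinf Rinf beta K).
  exact: (epi_sub_lift hQih hRih hbeta hW hQinf).
split.
  split; first exact: epi_sub.
  apply/seteqP; split.
    apply: (lift_sub_closure hQih hRih hbeta hQ2 hW hQinf hR2).
    (* The strict gap above the infimum provides an element of [Kbeta], the source of the strictly
       feasible point. *)
    move: hinf => /ereal_inf_lt [_ [K hK <-] hlt]; exists K.
    by split; [exact: hK|exact: hlt].
  apply: (subset_trans (closure_subset epi_sub)).
  exact: (closed_lift hRih hbeta hW hQinf).
split; first exact: Phi_smooth.
exists (fun q => (q.2 *m invmx q.1.2, q.1.1, q.1.2)).
have costE' (K : 'M[R]_(m, n)) (X : 'M[R]_n) : posdef X ->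
    R2 *m (K *m X) *m invmx X *m (K *m X)^T = R2 *m K *m X *m K^T.
  move=> dX; rewrite !mulmxA mulmxK; last exact: posdef_unit.
  by rewrite trmx_mul; case: dX => -> _; rewrite !mulmxA.
split; first (move=> [[K g] X] [dX [hc hr]]).
  split; first exact: dX.
  split; last by rewrite costE'.
  by apply/(Fcvx_nsdP A B hQih hRih hbeta hW hQinf) => //; case: dX.
split; first (move=> [[g X] Y] [dX [hF hc]]).
  have uX := posdef_unit dX.
  (* Reading Y as K X with K = Y X^-1 brings both conditions into the form used for the lifted
     set. *)
  have eY : Y = Y *m invmx X *m X by rewrite mulmxKV.
  rewrite eY in hF hc.
  split; first exact: dX.
  split; first by rewrite costE' in hc.
  by apply/(Fcvx_nsdP A B hQih hRih hbeta hW hQinf) => //; case: dX.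
split; first by move=> [[K g] X] [dX _] /=; rewrite mulmxK // posdef_unit.
split; first by move=> [[g X] Y] [dX _] /=; rewrite mulmxKV // posdef_unit.
apply: Phi_inv_smooth => -[[g X] Y] [dX _].
by rewrite /= -unitfE -unitmxE posdef_unit.
Qed.
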